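(* Let $p, q \geq 0$ be integers, let $R > r > 0$ be real numbers, and let $s, c, t \in \mathbb{R}^3$. Assume $|s| \geq R$, $|c| \leq r$, and $|t - c| \leq r - |c|$ (i.e. $t$ lies in the closed ball of radius $r-|c|$ centered at $c$). Let $\phi_s(x) = 1/|x-s|$, and let $\mathcal{L}_{0}^{p}[\phi_s]$ be the $p$-th order local expansion of $\phi_s$ centered at the origin, $\mathcal{L}_{c}^{q}[\phi_s]$ the $q$-th order local expansion of $\phi_s$ centered at $c$, and $\mathcal{L}_{c}^{q}[\mathcal{L}_{0}^{p}[\phi_s]]$ the $q$-th order local expansion centered at $c$ of the function $\mathcal{L}_{0}^{p}[\phi_s]$. Then $$\left| \mathcal{L}_{c}^{q}[\phi_s](t) - \mathcal{L}_{c}^{q}[\mathcal{L}_{0}^{p}[\phi_s]](t) \right| \leq \frac{1}{R-r}\left(\frac{r}{R}\right)^{p+1}.$$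
   Context: $|\cdot|$ is the Euclidean norm on $\mathbb{R}^3$ (and the modulus on $\mathbb{C}$); for $x \neq 0$, $\hat{x} = x/|x|$; $\mathbb{S}^2$ is the unit sphere in $\mathbb{R}^3$ with surface measure $dS$; $B(c,\rho)$ and $\bar B(c,\rho)$ are the open and closed Euclidean balls. Spherical harmonics: for integers $n \geq 0$, $-n \leq m \leq n$, and $\xi = (\sin\theta\cos\varphi, \sin\theta\sin\varphi, \cos\theta)\in\mathbb{S}^2$, $$Y_n^m(\xi) = \sqrt{\frac{2n+1}{4\pi}\frac{(n-m)!}{(n+m)!}}\, e^{im\varphi} P_n^m(\cos\theta),$$ where $P_n^m$ is the associated Legendre function of degree $n$ and order $m$ (with the usual convention for negative order $P_n^{-m} = (-1)^m \frac{(n-m)!}{(n+m)!}P_n^m$). They form an orthonormal basis of $L^2(\mathbb{S}^2)$ (complex inner product $\int_{\mathbb{S}^2} f\overline{g}\,dS$). Regular solid harmonics: $R_n^m(x) = |x|^n Y_n^m(\hat x)$ (with $R_n^m(0)=0$ for $n>0$ and $R_0^0 \equiv 1/\sqrt{4\pi}$). Local expansion: let $\rho>0$, $c\in\mathbb{R}^3$, and let $f$ be harmonic in $B(c,\rho)$ and continuous on $\bar B(c,\rho)$. Its local coefficients are $L_n^m = \rho^{-n}\int_{\mathbb{S}^2} f(c+\rho\xi)\overline{Y_n^m(\xi)}\,dS(\xi)$, and its $p$-th order local expansion centered at $c$ is $$\mathcal{L}_c^p[f](x) = \sum_{n=0}^p\sum_{m=-n}^n L_n^m R_n^m(x-c).$$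 The coefficients do not depend on the admissible choice of $\rho$. When $f$ is defined on a larger set, $\mathcal{L}_c^p[f]$ is understood using any $\rho>0$ for which the hypotheses hold; the expansion is a polynomial in $x$. *)

(* Defs.v *)
From Stdlib Require Import Reals ZArith Lra Psatz.
From Coquelicot Require Import Coquelicot.

Open Scope R_scope.

(* The vector operations are Coquelicot's [plus], [minus], [scal], [zero] on
   the product module; its product norm is not the Euclidean one (it is
   equivalent, so [continuous_on] is unaffected), hence [enorm]. *)
Definition R3 : Type := (R * R * R)%type.
Definition vec (x y z : R) : R3 := (x, y, z).
Definition px (v : R3) : R := fst (fst v).
Definition py (v : R3) : R := snd (fst v).
Definition pz (v : R3) : R := snd v.

Definition enorm (v : R3) : R := sqrt (px v ^ 2 + py v ^ 2 + pz v ^ 2).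

Definition eball (c : R3) (rho : R) (x : R3) : Prop := enorm (minus x c) < rho.
Definition ecball (c : R3) (rho : R) (x : R3) : Prop :=
  enorm (minus x c) <= rho.

Definition unit_vec (x : R3) : R3 := scal (/ enorm x) x.

Inductive axis : Set := ax1 | ax2 | ax3.

Definition basis (i : axis) : R3 :=
  match i with
  | ax1 => vec 1 0 0
  | ax2 => vec 0 1 0
  | ax3 => vec 0 0 1
  end.

Definition on_line (i : axis) (u : R3 -> R) (x : R3) : R -> R :=
  fun h => u (plus x (scal h (basis i))).

Definition partial (i : axis) (u : R3 -> R) (x : R3) : R :=
  Derive (on_line i u x) 0.

(* [of_class k D u]: [u] is of class C^k on [D], for [D] open. *)
Fixpoint of_class (k : nat) (D : R3 -> Prop) (u : R3 -> R) : Prop :=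
  continuous_on D u /\
  match k with
  | O => True
  | S k' => forall i : axis,
      (forall x, D x -> ex_derive (on_line i u x) 0) /\
      of_class k' D (partial i u)
  end.

Definition laplacian (u : R3 -> R) (x : R3) : R :=
  partial ax1 (partial ax1 u) x + partial ax2 (partial ax2 u) x +
  partial ax3 (partial ax3 u) x.

Definition harmonic_real (D : R3 -> Prop) (u : R3 -> R) : Prop :=
  of_class 2 D u /\ forall x, D x -> laplacian u x = 0.

Definition harmonic (D : R3 -> Prop) (f : R3 -> C) : Prop :=
  harmonic_real D (fun x => Re (f x)) /\ harmonic_real D (fun x => Im (f x)).

Definition spherical (theta phi : R) : R3 :=
  vec (sin theta * cos phi) (sin theta * sin phi) (cos theta).

Definition polar (xi : R3) : R := acos (pz xi).

(* Principal azimuth, in (-PI, PI]. On the z-axis the value is irrelevant. *)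
Definition azimuth (xi : R3) : R :=
  let a := acos (px xi / sqrt (px xi ^ 2 + py xi ^ 2)) in
  if Rle_dec 0 (py xi) then a else - a.

Lemma spherical_angles (xi : R3) :
  enorm xi = 1 -> spherical (polar xi) (azimuth xi) = xi.
Proof.
destruct xi as [[x y] z].
unfold enorm, spherical, polar, azimuth, vec, px, py, pz; simpl.
intros H.
assert (Hs : x * x + y * y + z * z = 1).
{ apply (f_equal (fun u => u * u)) in H.
  rewrite sqrt_sqrt in H by nra; lra. }
assert (Hz : -1 <= z <= 1) by nra.
rewrite cos_acos, sin_acos by lra.
replace (1 - Rsqr z) with (x * (x * 1) + y * (y * 1)) by (unfold Rsqr; lra).
set (w := sqrt (x * (x * 1) + y * (y * 1))).
assert (Hw : w * w = x * x + y * y).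
{ unfold w; rewrite sqrt_sqrt; nra. }
assert (Hw0 : 0 <= w) by apply sqrt_pos.
destruct (Req_dec w 0) as [W | W].
{ rewrite W in Hw |- *.
  replace x with 0 by nra; replace y with 0 by nra.
  repeat f_equal; ring. }
assert (Hxw : -1 <= x / w <= 1).
{ assert (0 < w) by lra.
  split; [apply Rle_div_r | apply Rle_div_l]; nra. }
assert (Hy : 1 - Rsqr (x / w) = Rsqr (y / w)).
{ unfold Rsqr. field_simplify_eq; [nra | exact W]. }
assert (Ha : sqrt (Rsqr (y / w)) = Rabs y / w).
{ rewrite sqrt_Rsqr_abs. unfold Rdiv.
  rewrite Rabs_mult, Rabs_inv, (Rabs_pos_eq w) by exact Hw0; reflexivity. }
destruct (Rle_dec 0 y) as [Y | Y].
- rewrite cos_acos, sin_acos, Hy, Ha, Rabs_pos_eq by lra.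
  repeat f_equal; field; exact W.
- rewrite cos_neg, sin_neg, cos_acos, sin_acos, Hy, Ha, Rabs_left by lra.
  repeat f_equal; field; exact W.
Qed.

(* Surface integral over S^2 with dS = sin theta dtheta dphi; only used for
   continuous integrands. *)
Definition sphere_int (g : R3 -> C) : C :=
  RInt (V := C_R_CompleteNormedModule)
    (fun theta =>
       RInt (V := C_R_CompleteNormedModule)
         (fun phi => (RtoC (sin theta) * g (spherical theta phi))%C)
         0 (2 * PI))
    0 PI.

(* Rodrigues' formula. *)
Definition legendre (n : nat) (x : R) : R :=
  Derive_n (fun u => (u ^ 2 - 1) ^ n) n x / (2 ^ n * INR (fact n)).

(* Order [m >= 0], with the Condon-Shortley phase; [sqrt (1 - x^2) ^ m] is
   (1 - x^2)^(m/2). *)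
Definition assoc_legendre_nat (n m : nat) (x : R) : R :=
  (-1) ^ m * sqrt (1 - x ^ 2) ^ m * Derive_n (legendre n) m x.

(* j! for j >= 0. *)
Definition factZ (j : Z) : R := INR (fact (Z.to_nat j)).

Definition assoc_legendre (n : nat) (m : Z) (x : R) : R :=
  let k := Z.abs_nat m in
  if (0 <=? m)%Z then assoc_legendre_nat n k x
  else (-1) ^ k * (INR (fact (n - k)) / INR (fact (n + k)))
       * assoc_legendre_nat n k x.

Definition Cexp_i (a : R) : C := (cos a, sin a).

Definition Y_angles (n : nat) (m : Z) (theta phi : R) : C :=
  (RtoC (sqrt ((2 * INR n + 1) / (4 * PI)
               * (factZ (Z.of_nat n - m) / factZ (Z.of_nat n + m))))
   * Cexp_i (IZR m * phi)
   * RtoC (assoc_legendre n m (cos theta)))%C.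

(* At the poles the choice of azimuth does not matter, since P_n^m(1) and
   P_n^m(-1) vanish for m <> 0. *)
Definition Y (n : nat) (m : Z) (xi : R3) : C :=
  Y_angles n m (polar xi) (azimuth xi).

(* At x = 0 this gives 0 for n > 0 and 1/sqrt(4 PI) for n = m = 0, because
   0 ^ 0 = 1 and Y 0 0 is constant. *)
Definition solid (n : nat) (m : Z) (x : R3) : C :=
  (RtoC (enorm x ^ n) * Y n m (unit_vec x))%C.

(* Sum over n = 0..p and m = -n..n, with m = k - n for k = 0..2n. *)
Definition sum_nm (p : nat) (F : nat -> Z -> C) : C :=
  sum_n (fun n =>
    sum_n (fun k => F n (Z.of_nat k - Z.of_nat n)%Z) (2 * n)%nat) p.

(* The radii with which the local coefficients of [f] at [c] may be formed. *)
Definition admissible_radius (f : R3 -> C) (c : R3) (rho : R) : Prop :=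
  0 < rho /\ harmonic (eball c rho) f /\ continuous_on (ecball c rho) f.

Definition local_coeff (f : R3 -> C) (c : R3) (rho : R) (n : nat) (m : Z) : C :=
  (RtoC (/ rho ^ n)
   * sphere_int (fun xi => f (plus c (scal rho xi)) * Cconj (Y n m xi)))%C.

Definition local_expansion (p : nat) (c : R3) (rho : R) (f : R3 -> C) (x : R3)
  : C :=
  sum_nm p (fun n m => (local_coeff f c rho n m * solid n m (minus x c))%C).

(* At x = s the value is a junk one; no ball admissible for [point_source s]
   contains s in its closure, as the function is unbounded near s. *)
Definition point_source (s : R3) (x : R3) : C :=
  RtoC (1 / enorm (minus x s)).

(* Main.v *)
Require Import Defs.
From Stdlib Require Import Reals ZArith Lra Lia Psatz.
From Coquelicot Require Import Coquelicot.

(** Both expansions are means, over one circle of directions, of truncated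
    geometric series, and the estimate holds for every direction separately.

    Complete the direction [e = s / |s|] to an orthonormal frame [(e, u, v)]
    and let [w = e + i (u cos a + v sin a)], a null vector of C^3. Laplace's
    integral reads [1 / |x - s| = mean of 1 / (|s| - x.w)] over the angle [a],
    for [|x| < |s|] (lemma [point_source_mean]). Since [w] is null, [(x.w) ^ k]
    is a homogeneous harmonic polynomial of degree [k], and [|x.w| <= |x|].
    Hence, if on a sphere about [c] a function is the uniform limit of means of
    [sum_j b_j ((x - c).w) ^ j], with coefficients [b_j] depending on [a], its
    local expansion of order [q] is the mean of the same sum over [j <= q]
    (lemmas [local_expansion_solid_sum] and [solid_sum_mean_coeff]).

    Write [z = c.w], [y = (t - c).w] and [L = |s|]. The expansion of order [q]
    about [c] of the potential is thus the mean of the part of degree at most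
    [q] in [y] of [1 / (L - z - y)], and that of its expansion of order [p] at
    the origin is the mean of the same part of
    [sum_(k <= p) (z + y) ^ k / L ^ (k + 1)]. The difference is the mean of the
    truncation of [((z + y) / L) ^ (p + 1) / (L - z - y)]. The power series of
    this function in [y] is majorized coefficientwise by the one with [|z|] in
    place of [z], whose coefficients are nonnegative; so the truncation is at
    most [((|z| + |y|) / L) ^ (p + 1) / (L - |z| - |y|)]
    (lemma [truncated_remainder_bound]), whatever [q] is. As
    [|z| + |y| <= |c| + |t - c| <= r] and [L >= R0], this is the claim.

    What has to be known about spherical harmonics is that the projection onto
    them reproduces [(x.w) ^ k]. The solid harmonics appear, up to constants, as
    the coefficients of a generating function whose powers are, for null [w],
    the forms [(2 x.w) ^ k] (lemma [null_power_expansion]); the recurrences read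
    off from the generating function give their orthogonality and their norms
    (lemmas [polar_inner_step] to [polar_inner_norm]) and identify them with
    Rodrigues' formula (lemma [solid_solid_poly]). *)

Open Scope R_scope.

(** * Points of R^3 *)

(** Restores the type [R], which [ring] recognizes, in an equation stated at
    the carrier of a structure on [R]. *)
Ltac eq_R := match goal with |- @eq _ ?a ?b => change (@eq R a b) end.

Lemma R3_ext (x y : R3) :
  px x = px y -> py x = py y -> pz x = pz y -> x = y.
Proof.
destruct x as [[x1 x2] x3], y as [[y1 y2] y3]; unfold px, py, pz; simpl.
congruence.
Qed.

Ltac R3_ring :=
  apply R3_ext; unfold minus;
  repeat match goal with
  | |- context [px (plus ?x ?y)] => change (px (plus x y)) with (px x + px y)
  | |- context [py (plus ?x ?y)] => change (py (plus x y)) with (py x + py y)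
  | |- context [pz (plus ?x ?y)] => change (pz (plus x y)) with (pz x + pz y)
  | |- context [px (opp ?x)] => change (px (opp x)) with (- px x)
  | |- context [py (opp ?x)] => change (py (opp x)) with (- py x)
  | |- context [pz (opp ?x)] => change (pz (opp x)) with (- pz x)
  | |- context [px (scal ?a ?x)] => change (px (scal a x)) with (a * px x)
  | |- context [py (scal ?a ?x)] => change (py (scal a x)) with (a * py x)
  | |- context [pz (scal ?a ?x)] => change (pz (scal a x)) with (a * pz x)
  | |- context [px zero] => change (px zero) with 0
  | |- context [py zero] => change (py zero) with 0
  | |- context [pz zero] => change (pz zero) with 0
  end; ring.

Definition rdot (x y : R3) : R := px x * px y + py x * py y + pz x * pz y.

Lemma enorm_sqr (x : R3) : enorm x ^ 2 = rdot x x.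
Proof. unfold enorm; rewrite pow2_sqrt; unfold rdot; nra. Qed.

Lemma enorm_ge_0 (x : R3) : 0 <= enorm x.
Proof. apply sqrt_pos. Qed.

Lemma enorm_zero : enorm zero = 0.
Proof.
unfold enorm. change (px zero) with 0; change (py zero) with 0.
change (pz zero) with 0.
replace (0 ^ 2 + 0 ^ 2 + 0 ^ 2) with 0 by ring. apply sqrt_0.
Qed.

Lemma enorm_zero_eq (x : R3) : enorm x = 0 -> x = zero.
Proof.
destruct x as [[x y] z]; unfold enorm, px, py, pz; simpl; intros H.
apply sqrt_eq_0 in H; [| nra].
assert (x = 0) by nra. assert (y = 0) by nra. assert (z = 0) by nra.
subst; reflexivity.
Qed.

Lemma enorm_scal (a : R) (x : R3) : enorm (scal a x) = Rabs a * enorm x.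
Proof.
unfold enorm.
change (px (scal a x)) with (a * px x); change (py (scal a x)) with (a * py x).
change (pz (scal a x)) with (a * pz x).
rewrite <- sqrt_Rsqr_abs, <- sqrt_mult_alt by apply Rle_0_sqr.
f_equal; unfold Rsqr; ring.
Qed.

Lemma coord_bound (x : R3) :
  Rabs (px x) <= enorm x /\ Rabs (py x) <= enorm x /\ Rabs (pz x) <= enorm x.
Proof.
unfold enorm; rewrite <- !sqrt_Rsqr_abs.
repeat split; apply sqrt_le_1_alt; unfold Rsqr; nra.
Qed.

Lemma enorm_triangle (x y : R3) : enorm (plus x y) <= enorm x + enorm y.
Proof.
pose proof (enorm_ge_0 x) as Hx; pose proof (enorm_ge_0 y) as Hy.
pose proof (enorm_ge_0 (plus x y)) as Hp.
assert (CS : rdot x y <= enorm x * enorm y).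
{ apply Rsqr_incr_0_var; [| now apply Rmult_le_pos].
  unfold Rsqr.
  replace (enorm x * enorm y * (enorm x * enorm y))
    with (enorm x ^ 2 * enorm y ^ 2) by ring.
  rewrite !enorm_sqr. unfold rdot.
  pose proof (pow2_ge_0 (px x * py y - py x * px y)).
  pose proof (pow2_ge_0 (px x * pz y - pz x * px y)).
  pose proof (pow2_ge_0 (py x * pz y - pz x * py y)).
  lra. }
apply Rsqr_incr_0_var; [| lra].
assert (E : enorm (plus x y) ^ 2 = enorm x ^ 2 + enorm y ^ 2 + 2 * rdot x y).
{ rewrite !enorm_sqr. unfold rdot.
  change (px (plus x y)) with (px x + px y).
  change (py (plus x y)) with (py x + py y).
  change (pz (plus x y)) with (pz x + pz y). ring. }
unfold Rsqr. lra.
Qed.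

Lemma minus_zero_R3 (x : R3) : minus x zero = x.
Proof. R3_ring. Qed.

(** * Finite complex sums *)

Definition Csum (f : nat -> C) (n : nat) : C := sum_n f n.

Lemma Csum_O (f : nat -> C) : Csum f 0 = f 0%nat.
Proof. apply (sum_O f). Qed.

Lemma Csum_S (f : nat -> C) (n : nat) : Csum f (S n) = (Csum f n + f (S n))%C.
Proof. apply (sum_Sn f). Qed.

Lemma Csum_ext (f g : nat -> C) (n : nat) :
  (forall k, (k <= n)%nat -> f k = g k) -> Csum f n = Csum g n.
Proof. apply (sum_n_ext_loc (G := C_AbelianMonoid)). Qed.

Lemma Csum_head (f : nat -> C) (n : nat) :
  Csum f (S n) = (f 0%nat + Csum (fun k => f (S k)) n)%C.
Proof.
induction n as [|n IH].
- now rewrite Csum_S, !Csum_O.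
- rewrite Csum_S, IH, (Csum_S (fun k => f (S k))); ring.
Qed.

Lemma Csum_plus (f g : nat -> C) (n : nat) :
  Csum (fun k => f k + g k)%C n = (Csum f n + Csum g n)%C.
Proof. apply (sum_n_plus f g). Qed.

Lemma Csum_mult_l (a : C) (f : nat -> C) (n : nat) :
  Csum (fun k => a * f k)%C n = (a * Csum f n)%C.
Proof. apply (sum_n_mult_l (K := C_Ring) a f). Qed.

Lemma Csum_mult_r (a : C) (f : nat -> C) (n : nat) :
  Csum (fun k => f k * a)%C n = (Csum f n * a)%C.
Proof. apply (sum_n_mult_r (K := C_Ring) a f). Qed.

Lemma Csum_zero (f : nat -> C) (n : nat) :
  (forall k, (k <= n)%nat -> f k = 0) -> Csum f n = 0.
Proof.
intros H; induction n as [|n IH].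
- rewrite Csum_O; auto.
- rewrite Csum_S, IH, H by auto; ring.
Qed.

Lemma Csum_single (f : nat -> C) (n j : nat) :
  (j <= n)%nat -> (forall k, (k <= n)%nat -> k <> j -> f k = 0) ->
  Csum f n = f j.
Proof.
intros Hj H; induction n as [|n IH].
- rewrite Csum_O; f_equal; lia.
- rewrite Csum_S. destruct (Nat.eq_dec j (S n)) as [-> | N].
  + rewrite Csum_zero; [ring |]. intros k Hk; apply H; lia.
  + rewrite IH, (H (S n)); [ring | lia | lia | lia |].
    intros k Hk; apply H; lia.
Qed.

Lemma Csum_Cmod (f : nat -> C) (n : nat) :
  Cmod (Csum f n) <= sum_n (fun k => Cmod (f k)) n.
Proof.
induction n as [|n IH].
- rewrite Csum_O, sum_O; apply Rle_refl.
- rewrite Csum_S, sum_Sn. eapply Rle_trans; [apply Cmod_triangle |].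
  now apply Rplus_le_compat_r.
Qed.

Lemma sum_n_le (f g : nat -> R) (n : nat) :
  (forall k, (k <= n)%nat -> f k <= g k) -> sum_n f n <= sum_n g n.
Proof. intros H. rewrite !sum_n_Reals. apply sum_Rle; auto. Qed.

(** Indexed as in [sum_nm], so that [local_expansion] unfolds to such sums. *)
Definition sum_orders (n : nat) (G : Z -> C) : C :=
  Csum (fun k => G (Z.of_nat k - Z.of_nat n)%Z) (2 * n).

Lemma sum_orders_ext (n : nat) (G G' : Z -> C) :
  (forall m, (Z.abs m <= Z.of_nat n)%Z -> G m = G' m) ->
  sum_orders n G = sum_orders n G'.
Proof. intros H; apply Csum_ext; intros k Hk; apply H; lia. Qed.

Lemma sum_orders_zero (n : nat) (G : Z -> C) :
  (forall m, (Z.abs m <= Z.of_nat n)%Z -> G m = 0) -> sum_orders n G = 0.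
Proof. intros H; apply Csum_zero; intros k Hk; apply H; lia. Qed.

Lemma sum_orders_single (n : nat) (G : Z -> C) (m : Z) :
  (Z.abs m <= Z.of_nat n)%Z ->
  (forall m', (Z.abs m' <= Z.of_nat n)%Z -> m' <> m -> G m' = 0) ->
  sum_orders n G = G m.
Proof.
intros Hm H. unfold sum_orders.
rewrite (Csum_single _ _ (Z.to_nat (m + Z.of_nat n))); [f_equal; lia | lia |].
intros k Hk N; apply H; lia.
Qed.

Lemma sum_orders_mult_l (a : C) (n : nat) (G : Z -> C) :
  (a * sum_orders n G)%C = sum_orders n (fun m => a * G m)%C.
Proof. symmetry; apply Csum_mult_l. Qed.

Lemma sum_orders_plus (n : nat) (G G' : Z -> C) :
  sum_orders n (fun m => G m + G' m)%C = (sum_orders n G + sum_orders n G')%C.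
Proof. apply Csum_plus. Qed.

(** Only vanishing terms enter or leave the range [-(n+1)..n+1]. *)
Lemma sum_orders_shift (n : nat) (G : Z -> C) (e : Z) :
  (Z.abs e <= 1)%Z -> (forall m, (Z.of_nat n < Z.abs m)%Z -> G m = 0) ->
  sum_orders (S n) (fun m => G (m + e)%Z) = sum_orders n G.
Proof.
intros He H. unfold sum_orders.
replace (2 * S n)%nat with (S (S (2 * n))) by lia.
assert (e = (-1) \/ e = 0 \/ e = 1)%Z as [-> | [-> | ->]] by lia.
- rewrite 2!Csum_head, 2!H by lia.
  rewrite 2!Cplus_0_l. apply Csum_ext; intros k _; f_equal; lia.
- rewrite Csum_head, Csum_S, 2!H by lia.
  rewrite Cplus_0_l, Cplus_0_r. apply Csum_ext; intros k _; f_equal; lia.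
- rewrite 2!Csum_S, 2!H by lia.
  rewrite 2!Cplus_0_r. apply Csum_ext; intros k _; f_equal; lia.
Qed.

(** * The solid harmonics as coefficients of a generating function *)

Definition xy_plus (x : R3) : C := (px x, py x).
Definition xy_minus (x : R3) : C := (px x, - py x).

(** [solid_poly n m x] is the coefficient of [zeta ^ m] in
    [((x1 + i x2) zeta + 2 x3 - (x1 - i x2) / zeta) ^ n]; it is the regular
    solid harmonic up to a constant factor, and is visibly a polynomial. *)
Fixpoint solid_poly (n : nat) (m : Z) (x : R3) : C :=
  match n with
  | O => if (m =? 0)%Z then 1 else 0
  | S n' => (xy_plus x * solid_poly n' (m - 1) x
             + 2 * pz x * solid_poly n' m x
             - xy_minus x * solid_poly n' (m + 1) x)%C
  end.

(** The factor of [solid_poly] that depends on the polar angle only, as a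
    function of [c = cos theta] and [s = sin theta]. *)
Fixpoint polar_poly (n : nat) (m : Z) (c s : R) : R :=
  match n with
  | O => if (m =? 0)%Z then 1 else 0
  | S n' => s * polar_poly n' (m - 1) c s + 2 * c * polar_poly n' m c s
            - s * polar_poly n' (m + 1) c s
  end.

Lemma solid_poly_support (n : nat) (m : Z) (x : R3) :
  (Z.of_nat n < Z.abs m)%Z -> solid_poly n m x = 0.
Proof.
revert m; induction n as [|n IH]; intros m Hm; simpl.
- destruct (Z.eqb_spec m 0); [lia | reflexivity].
- rewrite !IH by lia; ring.
Qed.

Lemma polar_poly_support (n : nat) (m : Z) (c s : R) :
  (Z.of_nat n < Z.abs m)%Z -> polar_poly n m c s = 0.
Proof.
revert m; induction n as [|n IH]; intros m Hm; simpl.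
- destruct (Z.eqb_spec m 0); [lia | reflexivity].
- rewrite !IH by lia; ring.
Qed.

Lemma polar_poly_top (n : nat) (c s : R) :
  polar_poly n (Z.of_nat n) c s = s ^ n.
Proof.
induction n as [|n IH]; [reflexivity |].
cbn [polar_poly]. replace (Z.of_nat (S n) - 1)%Z with (Z.of_nat n) by lia.
rewrite IH, !polar_poly_support by lia. simpl; ring.
Qed.

(** The substitution [zeta -> -1/zeta] preserves the generating function. *)
Lemma polar_poly_opp (n : nat) (k : nat) (c s : R) :
  polar_poly n (- Z.of_nat k) c s = (-1) ^ k * polar_poly n (Z.of_nat k) c s.
Proof.
revert k; induction n as [|n IH]; intros k; cbn [polar_poly].
- destruct k; simpl; ring.
- destruct k as [|k].
  + pose proof (IH 1%nat) as H; simpl Z.of_nat in *; simpl in H |- *.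
    replace (0 - 1)%Z with (-1)%Z by lia. rewrite H; ring.
  + replace (- Z.of_nat (S k) - 1)%Z with (- Z.of_nat (S (S k)))%Z by lia.
    replace (- Z.of_nat (S k) + 1)%Z with (- Z.of_nat k)%Z by lia.
    replace (Z.of_nat (S k) - 1)%Z with (Z.of_nat k) by lia.
    replace (Z.of_nat (S k) + 1)%Z with (Z.of_nat (S (S k))) by lia.
    rewrite !IH. simpl pow; ring.
Qed.

Lemma Cexp_i_plus (a b : R) : Cexp_i (a + b) = (Cexp_i a * Cexp_i b)%C.
Proof.
unfold Cexp_i, Cmult; simpl. rewrite cos_plus, sin_plus. f_equal; ring.
Qed.

Lemma Cexp_i_conj (a : R) : Cconj (Cexp_i a) = Cexp_i (- a).
Proof. unfold Cconj, Cexp_i; simpl. now rewrite cos_neg, sin_neg. Qed.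

Lemma solid_poly_spherical (n : nat) (m : Z) (theta phi : R) :
  solid_poly n m (spherical theta phi)
  = (Cexp_i (IZR m * phi) * polar_poly n m (cos theta) (sin theta))%C.
Proof.
revert m; induction n as [|n IH]; intros m; cbn [solid_poly polar_poly].
- destruct (Z.eqb_spec m 0) as [-> | N]; [| ring].
  unfold Cexp_i; rewrite Rmult_0_l, cos_0, sin_0.
  unfold RtoC, Cmult; simpl; f_equal; ring.
- rewrite !IH, minus_IZR, plus_IZR.
  assert (Hp : xy_plus (spherical theta phi) = (sin theta * Cexp_i phi)%C)
    by (unfold xy_plus, spherical, px, py, Cexp_i, RtoC, Cmult; simpl;
        f_equal; ring).
  assert (Hm : xy_minus (spherical theta phi) = (sin theta * Cexp_i (- phi))%C)
    by (unfold xy_minus, spherical, px, py, Cexp_i, RtoC, Cmult; simpl;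
        rewrite cos_neg, sin_neg; f_equal; ring).
  rewrite Hp, Hm; change (pz (spherical theta phi)) with (cos theta).
  assert (E0 : Cexp_i (IZR m * phi)
               = (Cexp_i ((IZR m - 1) * phi) * Cexp_i phi)%C)
    by (rewrite <- Cexp_i_plus; f_equal; ring).
  assert (E1 : Cexp_i (IZR m * phi)
               = (Cexp_i ((IZR m + 1) * phi) * Cexp_i (- phi))%C)
    by (rewrite <- Cexp_i_plus; f_equal; ring).
  rewrite RtoC_minus, RtoC_plus, !RtoC_mult.
  transitivity (sin theta * (Cexp_i ((IZR m - 1) * phi) * Cexp_i phi)
                  * polar_poly n (m - 1) (cos theta) (sin theta)
                + 2 * cos theta * Cexp_i (IZR m * phi)
                  * polar_poly n m (cos theta) (sin theta)
                - sin theta * (Cexp_i ((IZR m + 1) * phi) * Cexp_i (- phi))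
                  * polar_poly n (m + 1) (cos theta) (sin theta))%C; [ring |].
  rewrite <- E0, <- E1; ring.
Qed.

Lemma solid_poly_scal (n : nat) (m : Z) (a : R) (x : R3) :
  solid_poly n m (scal a x) = (a ^ n * solid_poly n m x)%C.
Proof.
assert (Hp : xy_plus (scal a x) = (a * xy_plus x)%C)
  by (unfold xy_plus, px, py, RtoC, Cmult; simpl; f_equal;
      unfold scal; simpl; unfold mult; simpl; ring).
assert (Hm : xy_minus (scal a x) = (a * xy_minus x)%C)
  by (unfold xy_minus, px, py, RtoC, Cmult; simpl; f_equal;
      unfold scal; simpl; unfold mult; simpl; ring).
assert (Hz : RtoC (pz (scal a x)) = (a * pz x)%C)
  by (rewrite <- RtoC_mult; reflexivity).
revert m; induction n as [|n IH]; intros m; cbn [solid_poly].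
- simpl; ring.
- rewrite !IH, Hp, Hm, Hz, Cpow_S; ring.
Qed.

Lemma solid_poly_bound (n : nat) (m : Z) (x : R3) :
  enorm x = 1 -> Cmod (solid_poly n m x) <= 4 ^ n.
Proof.
intros Hx. destruct (coord_bound x) as [_ [_ Hz]].
assert (Hxy : px x ^ 2 + py x ^ 2 <= 1).
{ replace 1 with (enorm x ^ 2) by (rewrite Hx; ring).
  rewrite enorm_sqr; unfold rdot; nra. }
rewrite Hx in Hz.
assert (Hp : Cmod (xy_plus x) <= 1).
{ rewrite <- sqrt_1. apply sqrt_le_1_alt. simpl in *. lra. }
assert (Hm : Cmod (xy_minus x) <= 1).
{ rewrite <- sqrt_1. apply sqrt_le_1_alt. simpl in *. lra. }
revert m; induction n as [|n IH]; intros m; cbn [solid_poly].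
- destruct (m =? 0)%Z; rewrite ?Cmod_1, ?Cmod_0; simpl; lra.
- eapply Rle_trans; [apply Cmod_triangle |].
  rewrite Cmod_opp.
  eapply Rle_trans; [apply Rplus_le_compat_r, Cmod_triangle |].
  rewrite !Cmod_mult, !Cmod_R, (Rabs_pos_eq 2) by lra.
  pose proof (IH (m - 1)%Z); pose proof (IH m); pose proof (IH (m + 1)%Z).
  pose proof (Cmod_ge_0 (solid_poly n (m - 1) x)).
  pose proof (Cmod_ge_0 (solid_poly n m x)).
  pose proof (Cmod_ge_0 (solid_poly n (m + 1) x)).
  pose proof (Cmod_ge_0 (xy_plus x)); pose proof (Cmod_ge_0 (xy_minus x)).
  pose proof (Rabs_pos (pz x)).
  simpl pow. nra.
Qed.

(** * Powers of null linear forms *)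

Record C3 : Type := mkC3 { c1 : C; c2 : C; c3 : C }.

(** Bilinear, not Hermitian, so that the square of a form [x.w] has Laplacian
    [2 w.w], which vanishes for null [w]. *)
Definition cdot (x : R3) (w : C3) : C :=
  (px x * c1 w + py x * c2 w + pz x * c3 w)%C.

Definition null_vector (w : C3) : Prop :=
  (c1 w * c1 w + c2 w * c2 w + c3 w * c3 w)%C = 0.

(** The coefficient of [solid_poly n m] in [(2 x.w) ^ n]. With
    [A = w1 - i w2] and [B = - (w1 + i w2)] one has [A B = w3 ^ 2] for null
    [w], so that for [w3 <> 0] it is [(A / w3) ^ m w3 ^ n]; this form avoids
    the division. *)
Definition null_coeff (n : nat) (m : Z) (w : C3) : C :=
  ((if (0 <=? m)%Z then c1 w - Ci * c2 w else - (c1 w + Ci * c2 w))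
     ^ Z.abs_nat m * c3 w ^ (n - Z.abs_nat m))%C.

Lemma null_coeff_S (n : nat) (m : Z) (w : C3) :
  (Z.abs m <= Z.of_nat n)%Z ->
  null_coeff (S n) m w = (c3 w * null_coeff n m w)%C.
Proof.
intros Hm. unfold null_coeff.
replace (S n - Z.abs_nat m)%nat with (S (n - Z.abs_nat m)) by lia.
rewrite Cpow_S; ring.
Qed.

Lemma Ci_sqr : (Ci * Ci)%C = (- (1))%C.
Proof. unfold Ci, Cmult, Copp, RtoC; simpl; f_equal; ring. Qed.

Lemma Cpair_eq (a b : R) : (a, b) = (a + Ci * b)%C :> C.
Proof. unfold Ci, Cmult, Cplus, RtoC; simpl; f_equal; ring. Qed.

Lemma null_vector_factor (w : C3) :
  null_vector w ->
  ((c1 w - Ci * c2 w) * - (c1 w + Ci * c2 w))%C = (c3 w * c3 w)%C.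
Proof.
intros Hw.
transitivity (c3 w * c3 w - (c1 w * c1 w - (Ci * Ci) * (c2 w * c2 w)
              + c3 w * c3 w) + (c1 w * c1 w + c2 w * c2 w + c3 w * c3 w))%C.
- unfold null_vector in Hw; rewrite Hw. ring [Ci_sqr].
- ring [Ci_sqr].
Qed.

Lemma null_coeff_up (n : nat) (m : Z) (w : C3) :
  null_vector w -> (Z.abs m <= Z.of_nat n)%Z ->
  null_coeff (S n) (m + 1) w = ((c1 w - Ci * c2 w) * null_coeff n m w)%C.
Proof.
intros Hw Hm. unfold null_coeff.
destruct (Z.leb_spec 0 m) as [P | N].
- replace (0 <=? m + 1)%Z with true by (symmetry; apply Z.leb_le; lia).
  replace (Z.abs_nat (m + 1)) with (S (Z.abs_nat m)) by lia.
  replace (S n - S (Z.abs_nat m))%nat with (n - Z.abs_nat m)%nat by lia.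
  rewrite Cpow_S; ring.
- pose proof (null_vector_factor w Hw) as Hab.
  replace (Z.abs_nat m) with (S (Z.abs_nat (m + 1))) by lia.
  replace (S n - Z.abs_nat (m + 1))%nat
    with (S (S (n - S (Z.abs_nat (m + 1))))) by lia.
  rewrite !Cpow_S.
  destruct (Z.leb_spec 0 (m + 1)) as [P' | N'].
  + replace (Z.abs_nat (m + 1)) with 0%nat by lia. rewrite !Cmult_assoc.
    rewrite Hab. simpl; ring.
  + rewrite !Cmult_assoc, Hab. ring.
Qed.

Lemma null_coeff_down (n : nat) (m : Z) (w : C3) :
  null_vector w -> (Z.abs m <= Z.of_nat n)%Z ->
  null_coeff (S n) (m - 1) w = (- (c1 w + Ci * c2 w) * null_coeff n m w)%C.
Proof.
intros Hw Hm. unfold null_coeff.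
destruct (Z.leb_spec 0 (m - 1)) as [P | N].
- pose proof (null_vector_factor w Hw) as Hab.
  rewrite Cmult_comm in Hab.
  replace (0 <=? m)%Z with true by (symmetry; apply Z.leb_le; lia).
  replace (Z.abs_nat m) with (S (Z.abs_nat (m - 1))) by lia.
  replace (S n - Z.abs_nat (m - 1))%nat
    with (S (S (n - S (Z.abs_nat (m - 1))))) by lia.
  rewrite !Cpow_S, !Cmult_assoc, Hab. ring.
- replace (Z.abs_nat (m - 1)) with (S (Z.abs_nat m)) by lia.
  replace (S n - S (Z.abs_nat m))%nat with (n - Z.abs_nat m)%nat by lia.
  destruct (Z.leb_spec 0 m) as [P' | N'].
  + replace (Z.abs_nat m) with 0%nat by lia. simpl; ring.
  + rewrite Cpow_S; ring.
Qed.

(** The generating function of [solid_poly], homogenized: multiplying a sum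
    over the orders by [2 x.w = x_+ A - x_- B + 2 x3 w3] shifts the orders of
    the coefficients by [1], [-1] and [0]. *)
Lemma null_power_expansion (n : nat) (w : C3) (x : R3) :
  null_vector w ->
  ((2 * cdot x w) ^ n)%C
  = sum_orders n (fun m => null_coeff n m w * solid_poly n m x)%C.
Proof.
intros Hw; induction n as [|n IH].
- unfold sum_orders; simpl (2 * 0)%nat; rewrite Csum_O.
  unfold null_coeff; simpl; ring.
- rewrite Cpow_S, IH, sum_orders_mult_l.
  set (U := fun m => (null_coeff (S n) (m + 1) w * solid_poly n m x)%C).
  set (V := fun m => (null_coeff (S n) m w * solid_poly n m x)%C).
  set (W := fun m => (null_coeff (S n) (m - 1) w * solid_poly n m x)%C).
  rewrite (sum_orders_ext (S n) _ (fun m => xy_plus x * U (m + -1)%Z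
    + (2 * pz x * V (m + 0)%Z + (- xy_minus x) * W (m + 1)%Z))%C).
  2: { intros m Hm; unfold U, V, W; cbn [solid_poly].
    replace (m + -1 + 1)%Z with m by lia. replace (m + 1 - 1)%Z with m by lia.
    replace (m + 0)%Z with m by lia. replace (m + -1)%Z with (m - 1)%Z by lia.
    ring. }
  rewrite !sum_orders_plus, <- !sum_orders_mult_l.
  rewrite (sum_orders_shift n U), (sum_orders_shift n V),
    (sum_orders_shift n W); try lia.
  2, 3, 4: intros m Hm; unfold U, V, W;
    rewrite solid_poly_support by exact Hm; ring.
  rewrite !sum_orders_mult_l, <- !sum_orders_plus.
  apply sum_orders_ext; intros m Hm.
  unfold U, V, W; rewrite null_coeff_up, null_coeff_down,
    null_coeff_S by assumption.
  unfold cdot, xy_plus, xy_minus.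
  rewrite (Cpair_eq (px x) (py x)), (Cpair_eq (px x) (- py x)), RtoC_opp.
  ring [Ci_sqr].
Qed.

(** * Orthogonality in the polar angle *)

(** Together with [polar_poly_derive], this is all that integration by parts
    needs; both follow by induction from the recurrence defining
    [polar_poly]. *)
Lemma polar_poly_contiguous (n : nat) (m : Z) (c s : R) :
  2 * IZR m * c * polar_poly n m c s
  = s * ((INR n - IZR m + 1) * polar_poly n (m - 1) c s
         + (INR n + IZR m + 1) * polar_poly n (m + 1) c s).
Proof.
revert m; induction n as [|n IH]; intros m.
- simpl. destruct (Z.eqb_spec m 0) as [-> | N]; simpl; [ring |].
  destruct (Z.eqb_spec (m - 1) 0) as [E | N1].
  + replace m with 1%Z by lia. simpl. ring.
  + destruct (Z.eqb_spec (m + 1) 0) as [E | N2]; [| ring].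
    replace m with (-1)%Z by lia. simpl. ring.
- cbn [polar_poly]. rewrite S_INR.
  pose proof (IH (m - 1)%Z) as Hd; pose proof (IH m) as H0.
  pose proof (IH (m + 1)%Z) as Hu.
  rewrite minus_IZR in Hd; rewrite plus_IZR in Hu.
  replace (m - 1 + 1)%Z with m in * by lia.
  replace (m + 1 - 1)%Z with m in * by lia.
  apply Rminus_diag_uniq; apply Rminus_diag_eq in Hd, H0, Hu.
  match type of Hd with ?d = 0 => match type of H0 with ?z = 0 =>
  match type of Hu with ?u = 0 =>
    transitivity (s * d + 2 * c * z - s * u); [ring | rewrite Hd, H0, Hu; ring]
  end end end.
Qed.

Lemma polar_poly_derive (n : nat) (m : Z) (theta : R) :
  is_derive (fun th => polar_poly n m (cos th) (sin th)) theta
    (/ 2 * ((INR n - IZR m + 1) * polar_poly n (m - 1) (cos theta) (sin theta)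
            - (INR n + IZR m + 1)
              * polar_poly n (m + 1) (cos theta) (sin theta))).
Proof.
revert m; induction n as [|n IH]; intros m.
- simpl. evar_last; [apply @is_derive_const |].
  change (@zero R_NormedModule) with 0.
  destruct (Z.eqb_spec (m - 1) 0) as [E | N1].
  + replace m with 1%Z by lia; simpl; ring.
  + destruct (Z.eqb_spec (m + 1) 0) as [E | N2]; [| ring].
    replace m with (-1)%Z by lia; simpl; ring.
- cbn [polar_poly].
  pose proof (IH (m - 1)%Z) as Hd; pose proof (IH m) as H0.
  pose proof (IH (m + 1)%Z) as Hu.
  set (f := fun th => polar_poly n (m - 1) (cos th) (sin th)) in Hd.
  set (g := fun th => polar_poly n m (cos th) (sin th)) in H0.
  set (h := fun th => polar_poly n (m + 1) (cos th) (sin th)) in Hu.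
  apply is_derive_ext with
    (fun th => sin th * f th + 2 * cos th * g th - sin th * h th);
    [reflexivity |].
  auto_derive.
  + repeat split; try (eexists; eassumption); auto.
  + change (Derive (fun x : R => f x) theta) with (Derive f theta).
    change (Derive (fun x : R => g x) theta) with (Derive g theta).
    change (Derive (fun x : R => h x) theta) with (Derive h theta).
    rewrite (is_derive_unique f _ _ Hd), (is_derive_unique g _ _ H0),
      (is_derive_unique h _ _ Hu).
    unfold f, g, h. rewrite S_INR, !minus_IZR, !plus_IZR.
    replace (m - 1 + 1)%Z with m by lia.
    replace (m + 1 - 1)%Z with m by lia. field.
Qed.

Definition polar_product (k n : nat) (m : Z) (theta : R) : R :=
  sin theta * (polar_poly k m (cos theta) (sin theta)
               * polar_poly n m (cos theta) (sin theta)).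

Definition polar_inner (k n : nat) (m : Z) : R :=
  RInt (polar_product k n m) 0 PI.

Lemma polar_poly_continuous (n : nat) (m : Z) (theta : R) :
  continuous (fun th => polar_poly n m (cos th) (sin th)) theta.
Proof.
apply (ex_derive_continuous (V := R_NormedModule)).
eexists; apply polar_poly_derive.
Qed.

Lemma polar_product_continuous (k n : nat) (m : Z) (theta : R) :
  continuous (polar_product k n m) theta.
Proof.
apply (continuous_mult (K := R_AbsRing)); [apply continuous_sin |].
apply (continuous_mult (K := R_AbsRing)); apply polar_poly_continuous.
Qed.

Lemma polar_product_RInt (k n : nat) (m : Z) :
  is_RInt (polar_product k n m) 0 PI (polar_inner k n m).
Proof.
apply (RInt_correct (V := R_CompleteNormedModule)), ex_RInt_continuous.
intros; apply polar_product_continuous.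
Qed.

Lemma polar_inner_sym (k n : nat) (m : Z) :
  polar_inner k n m = polar_inner n k m.
Proof.
apply (RInt_ext (V := R_CompleteNormedModule)); intros x _.
unfold polar_product; eq_R; ring.
Qed.

(** Integrate the derivative of
    [sin * polar_poly k m * polar_poly n (m - 1)], which vanishes at both
    poles. *)
Lemma polar_inner_step (k n : nat) (m : Z) :
  (INR n + IZR m) * polar_inner k n m
  = (INR k - IZR m + 1) * polar_inner k n (m - 1).
Proof.
set (F := fun th => sin th * (polar_poly k m (cos th) (sin th)
                    * polar_poly n (m - 1) (cos th) (sin th))).
set (dF := fun th => (INR k - IZR m + 1) * polar_product k n (m - 1) th
                     - (INR n + IZR m) * polar_product k n m th).
assert (HF : is_RInt dF 0 PI 0).
{ evar_last.
  - apply (is_RInt_derive (V := R_CompleteNormedModule) F dF).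
    + intros th _. unfold F, dF, polar_product.
      pose proof (polar_poly_derive k m th) as Hf.
      pose proof (polar_poly_derive n (m - 1) th) as Hg.
      set (f := fun th => polar_poly k m (cos th) (sin th)) in Hf.
      set (g := fun th => polar_poly n (m - 1) (cos th) (sin th)) in Hg.
      apply is_derive_ext with (fun th => sin th * (f th * g th));
        [reflexivity |].
      auto_derive.
      * repeat split; try (eexists; eassumption); auto.
      * change (Derive (fun x : R => f x) th) with (Derive f th).
        change (Derive (fun x : R => g x) th) with (Derive g th).
        rewrite (is_derive_unique f _ _ Hf), (is_derive_unique g _ _ Hg).
        unfold f, g. rewrite minus_IZR.
        pose proof (polar_poly_contiguous k m (cos th) (sin th)) as Ck.
        pose proof (polar_poly_contiguous n (m - 1) (cos th) (sin th)) as Cn.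
        rewrite minus_IZR in Cn.
        replace (m - 1 + 1)%Z with m in * by lia.
        apply Rminus_diag_uniq; apply Rminus_diag_eq in Ck, Cn.
        match type of Ck with ?d = 0 => match type of Cn with ?e = 0 =>
          transitivity
            (/ 2 * (d * polar_poly n (m - 1) (cos th) (sin th)
                    - e * polar_poly k m (cos th) (sin th)));
          [field | rewrite Ck, Cn; ring]
        end end.
    + intros th _. unfold dF.
      apply (continuous_minus (V := R_NormedModule));
        apply (continuous_mult (K := R_AbsRing));
        try apply continuous_const; apply polar_product_continuous.
  - unfold F; rewrite sin_PI, sin_0. unfold minus, plus, opp; simpl; ring. }
assert (HdF : is_RInt dF 0 PI ((INR k - IZR m + 1) * polar_inner k n (m - 1)
                               - (INR n + IZR m) * polar_inner k n m)).
{ apply (is_RInt_minus (V := R_NormedModule));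
  apply (is_RInt_scal (V := R_NormedModule)); apply polar_product_RInt. }
apply (is_RInt_unique (V := R_CompleteNormedModule)) in HF, HdF.
rewrite HF in HdF; lra.
Qed.

(** The two recurrences given by [polar_inner_step] for the same integrals
    differ by the factor [k (k + 1) - n (n + 1)]. *)
Lemma polar_inner_orthogonal (k n : nat) (m : Z) :
  k <> n -> polar_inner k n m = 0.
Proof.
intros N.
pose proof (polar_inner_step k n (m + 1)) as H1.
pose proof (polar_inner_step n k (m + 1)) as H2.
rewrite !(polar_inner_sym n k) in H2.
replace (m + 1 - 1)%Z with m in * by lia. rewrite plus_IZR in *.
assert (H : (INR k - INR n) * (INR k + INR n + 1) * polar_inner k n m = 0).
{ transitivity
    ((INR k + (IZR m + 1)) * ((INR k - (IZR m + 1) + 1) * polar_inner k n m)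
     - (INR n + (IZR m + 1)) * ((INR n - (IZR m + 1) + 1) * polar_inner k n m));
    [ring |].
  rewrite <- H1, <- H2; ring. }
apply Rmult_integral in H as [H | H]; [| exact H].
pose proof (pos_INR k); pose proof (pos_INR n).
apply Rmult_integral in H as [H | H]; [| lra].
exfalso; apply N, INR_eq; lra.
Qed.

(** Wallis' recurrence, from the derivative of [cos * sin ^ (2 n + 2)]. *)
Lemma sin_odd_power_RInt (n : nat) :
  is_RInt (fun th => sin th ^ (2 * n + 1)) 0 PI
    (2 * 4 ^ n * INR (fact n) ^ 2 / INR (fact (2 * n + 1))).
Proof.
induction n as [|n IH].
- simpl. apply is_RInt_ext with sin; [intros; eq_R; ring |].
  evar_last.
  + apply (is_RInt_derive (V := R_CompleteNormedModule) (fun x => - cos x) sin).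
    * intros x _; auto_derive; [auto | ring].
    * intros x _; apply continuous_sin.
  + rewrite cos_PI, cos_0. unfold minus, plus, opp; simpl; field.
- assert (H : is_RInt (fun th => (2 * INR n + 2) * sin th ^ (2 * n + 1)
                         - (2 * INR n + 3) * sin th ^ (2 * S n + 1)) 0 PI 0).
  { evar_last.
    - apply (is_RInt_derive (V := R_CompleteNormedModule)
               (fun th => cos th * sin th ^ (2 * n + 2))).
      + intros x _; auto_derive; [auto |].
        replace (n + (n + 0) + 2)%nat with (S (2 * n + 1)) by lia.
        replace (2 * S n + 1)%nat with (S (S (2 * n + 1))) by lia.
        cbn [Init.Nat.pred]. rewrite S_INR, plus_INR, mult_INR.
        cbn [pow]. set (P := sin x ^ (2 * n + 1)).
        pose proof (sin2_cos2 x) as T; unfold Rsqr in T. simpl INR.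
        replace (cos x * (1 * cos x * ((((1 + 1) * INR n + 1) + 1) * P)))
          with ((cos x * cos x) * ((2 * INR n + 2) * P)) by ring.
        replace (cos x * cos x) with (1 - sin x * sin x) by lra. ring.
      + intros x _. apply (ex_derive_continuous (V := R_NormedModule)).
        auto_derive; auto.
    - rewrite sin_PI, sin_0, pow_i by lia.
      unfold minus, plus, opp; simpl; ring. }
  apply (is_RInt_scal (V := R_NormedModule)) with (k := 2 * INR n + 2) in IH.
  apply (is_RInt_minus (V := R_NormedModule) _ _ _ _ _ _ IH) in H.
  apply (is_RInt_scal (V := R_NormedModule)) with (k := / (2 * INR n + 3)) in H.
  pose proof (pos_INR n).
  evar_last; [eapply is_RInt_ext; [| exact H] |].
  + intros x _. unfold scal, minus, plus, opp; simpl; unfold mult; simpl.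
    field; lra.
  + replace (2 * S n + 1)%nat with (S (S (2 * n + 1))) by lia.
    rewrite (fact_simpl n), !(fact_simpl (S _)), (fact_simpl (2 * n + 1)).
    rewrite !mult_INR, !S_INR, !plus_INR, !mult_INR.
    pose proof (INR_fact_neq_0 (2 * n + 1)).
    change (/ (2 * INR n + 3) * ((2 * INR n + 2)
              * (2 * 4 ^ n * INR (fact n) ^ 2 / INR (fact (2 * n + 1))) + - 0)
            = 2 * 4 ^ S n * ((INR n + 1) * INR (fact n)) ^ 2
              / ((2 * INR n + 1 + 1 + 1)
                 * ((2 * INR n + 1 + 1) * INR (fact (2 * n + 1))))).
    simpl (4 ^ S n). field. repeat split; try assumption; lra.
Qed.

(** Descend by [polar_inner_step] from the order [m = n], where
    [polar_poly n n = sin ^ n]. *)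
Lemma polar_inner_norm (n : nat) (m : Z) :
  (Z.abs m <= Z.of_nat n)%Z ->
  polar_inner n n m * (factZ (Z.of_nat n - m) * factZ (Z.of_nat n + m))
    * (2 * INR n + 1) = 2 * 4 ^ n * INR (fact n) ^ 2.
Proof.
intros Hm.
assert (Top : polar_inner n n (Z.of_nat n)
              = 2 * 4 ^ n * INR (fact n) ^ 2 / INR (fact (2 * n + 1))).
{ apply (is_RInt_unique (V := R_CompleteNormedModule)).
  eapply is_RInt_ext; [| apply sin_odd_power_RInt].
  intros x _. unfold polar_product. rewrite polar_poly_top. eq_R.
  rewrite pow_add, pow_mult. simpl. rewrite Rmult_1_r, Rpow_mult_distr.
  ring. }
replace m with (Z.of_nat n - Z.of_nat (Z.to_nat (Z.of_nat n - m)))%Z by lia.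
assert (Hj : (Z.to_nat (Z.of_nat n - m) <= 2 * n)%nat) by lia.
revert Hj; generalize (Z.to_nat (Z.of_nat n - m)) as j; clear m Hm.
induction j as [|j IH]; intros Hj.
- rewrite Z.sub_0_r, Top. unfold factZ. rewrite Z.sub_diag.
  replace (Z.to_nat (Z.of_nat n + Z.of_nat n)) with (2 * n)%nat by lia.
  replace (2 * n + 1)%nat with (S (2 * n)) by lia.
  rewrite fact_simpl, mult_INR, S_INR, mult_INR. simpl.
  change (n + (n + 0))%nat with (2 * n)%nat.
  pose proof (INR_fact_neq_0 (2 * n)). pose proof (pos_INR n).
  field. split; [assumption | lra].
- rewrite <- IH by lia.
  pose proof (polar_inner_step n n (Z.of_nat n - Z.of_nat j)) as St.
  replace (Z.of_nat n - Z.of_nat j - 1)%Z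
    with (Z.of_nat n - Z.of_nat (S j))%Z in St by lia.
  rewrite minus_IZR, <- !INR_IZR_INZ in St.
  unfold factZ.
  replace (Z.to_nat (Z.of_nat n - (Z.of_nat n - Z.of_nat (S j))))
    with (S j) by lia.
  replace (Z.to_nat (Z.of_nat n - (Z.of_nat n - Z.of_nat j))) with j by lia.
  replace (Z.to_nat (Z.of_nat n + (Z.of_nat n - Z.of_nat j)))
    with (S (Z.to_nat (Z.of_nat n + (Z.of_nat n - Z.of_nat (S j))))) by lia.
  set (N := Z.to_nat (Z.of_nat n + (Z.of_nat n - Z.of_nat (S j)))).
  assert (HN : INR (S N) = INR n + (INR n - INR j)).
  { assert (E : (S N + j = 2 * n)%nat) by lia.
    apply (f_equal INR) in E. rewrite plus_INR, mult_INR in E.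
    simpl (INR 2) in E. lra. }
  rewrite !fact_simpl, !mult_INR, HN, (S_INR j).
  transitivity (((INR n - (INR n - INR j) + 1)
                 * polar_inner n n (Z.of_nat n - Z.of_nat (S j)))
                * (INR (fact j) * INR (fact N)) * (2 * INR n + 1)); [ring |].
  rewrite <- St; ring.
Qed.

(** * The spherical harmonics of Rodrigues' formula *)

(** The coefficient of [h ^ (n + m)] in [((x + h) ^ 2 - 1) ^ n], hence the
    Taylor coefficient of order [n + m] of [(x ^ 2 - 1) ^ n]. *)
Fixpoint rodrigues_coeff (n : nat) (m : Z) (x : R) : R :=
  match n with
  | O => if (m =? 0)%Z then 1 else 0
  | S n' => rodrigues_coeff n' (m - 1) x + 2 * x * rodrigues_coeff n' m x
            + (x ^ 2 - 1) * rodrigues_coeff n' (m + 1) x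
  end.

Lemma rodrigues_coeff_support (n : nat) (m : Z) (x : R) :
  (Z.of_nat n < Z.abs m)%Z -> rodrigues_coeff n m x = 0.
Proof.
revert m; induction n as [|n IH]; intros m Hm; cbn [rodrigues_coeff].
- destruct (Z.eqb_spec m 0); [lia | reflexivity].
- rewrite !IH by lia; ring.
Qed.

Lemma rodrigues_coeff_derive (n : nat) (m : Z) (x : R) :
  is_derive (rodrigues_coeff n m) x
    ((INR n + IZR m + 1) * rodrigues_coeff n (m + 1) x).
Proof.
revert m; induction n as [|n IH]; intros m; cbn [rodrigues_coeff].
- evar_last; [apply @is_derive_const |].
  change (@zero R_NormedModule) with 0. simpl.
  destruct (Z.eqb_spec (m + 1) 0) as [E | N2]; [| ring].
  replace m with (-1)%Z by lia; simpl; ring.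
- pose proof (IH (m - 1)%Z) as Hd; pose proof (IH m) as H0.
  pose proof (IH (m + 1)%Z) as Hu.
  auto_derive.
  + repeat split; try (eexists; eassumption); auto.
  + change (Derive (fun x : R => rodrigues_coeff n (m - 1) x) x)
      with (Derive (rodrigues_coeff n (m - 1)) x).
    change (Derive (fun x : R => rodrigues_coeff n m x) x)
      with (Derive (rodrigues_coeff n m) x).
    change (Derive (fun x : R => rodrigues_coeff n (m + 1) x) x)
      with (Derive (rodrigues_coeff n (m + 1)) x).
    rewrite (is_derive_unique _ _ _ Hd), (is_derive_unique _ _ _ H0),
      (is_derive_unique _ _ _ Hu).
    rewrite S_INR, !minus_IZR, !plus_IZR.
    replace (m - 1 + 1)%Z with m by lia.
    replace (m + 1 - 1)%Z with m by lia. ring.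
Qed.

Lemma rodrigues_coeff_bottom (n : nat) (x : R) :
  rodrigues_coeff n (- Z.of_nat n) x = (x ^ 2 - 1) ^ n.
Proof.
induction n as [|n IH]; [reflexivity |].
cbn [rodrigues_coeff].
replace (- Z.of_nat (S n) + 1)%Z with (- Z.of_nat n)%Z by lia.
rewrite IH, !rodrigues_coeff_support by lia. simpl; ring.
Qed.

(** The substitution [h -> (x ^ 2 - 1) / h] preserves
    [(h + 2 x + (x ^ 2 - 1) / h) ^ n]. *)
Lemma rodrigues_coeff_opp (n k : nat) (x : R) :
  rodrigues_coeff n (- Z.of_nat k) x
  = (x ^ 2 - 1) ^ k * rodrigues_coeff n (Z.of_nat k) x.
Proof.
revert k; induction n as [|n IH]; intros k; cbn [rodrigues_coeff].
- destruct k; simpl; ring.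
- destruct k as [|k].
  + pose proof (IH 1%nat) as H. simpl Z.of_nat in *. simpl Z.opp in *.
    change (0 - 1)%Z with (-1)%Z; change (0 + 1)%Z with 1%Z.
    rewrite H; ring.
  + replace (- Z.of_nat (S k) - 1)%Z with (- Z.of_nat (S (S k)))%Z by lia.
    replace (- Z.of_nat (S k) + 1)%Z with (- Z.of_nat k)%Z by lia.
    replace (Z.of_nat (S k) - 1)%Z with (Z.of_nat k) by lia.
    replace (Z.of_nat (S k) + 1)%Z with (Z.of_nat (S (S k))) by lia.
    rewrite !IH. cbn [pow]; ring.
Qed.

(** Scaling [zeta] by [s] turns one generating function into the other. The
    orders are nonnegative here because [s] may vanish. *)
Lemma polar_poly_rodrigues (n k : nat) (c s : R) :
  s ^ 2 = 1 - c ^ 2 ->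
  polar_poly n (Z.of_nat k) c s = s ^ k * rodrigues_coeff n (Z.of_nat k) c.
Proof.
intros Hs; revert k; induction n as [|n IH]; intros k;
  cbn [rodrigues_coeff polar_poly].
- destruct k; simpl; ring.
- replace (c ^ 2 - 1) with (- s ^ 2) by lra. destruct k as [|k].
  + pose proof (polar_poly_opp n 1 c s) as Hp.
    pose proof (rodrigues_coeff_opp n 1 c) as Hr.
    pose proof (IH 0%nat) as H0; pose proof (IH 1%nat) as H1.
    simpl Z.of_nat in *; simpl Z.opp in *.
    change (0 - 1)%Z with (-1)%Z; change (0 + 1)%Z with 1%Z.
    rewrite Hp, Hr, H1, H0.
    replace (c ^ 2 - 1) with (- s ^ 2) by lra. ring.
  + replace (Z.of_nat (S k) - 1)%Z with (Z.of_nat k) by lia.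
    replace (Z.of_nat (S k) + 1)%Z with (Z.of_nat (S (S k))) by lia.
    rewrite !IH. cbn [pow]; ring.
Qed.

Lemma rodrigues_Derive_n (n j : nat) (x : R) :
  Derive_n (fun u => (u ^ 2 - 1) ^ n) j x
  = INR (fact j) * rodrigues_coeff n (Z.of_nat j - Z.of_nat n) x.
Proof.
revert x; induction j as [|j IH]; intros x; cbn [Derive_n].
- simpl (Z.of_nat 0). rewrite <- rodrigues_coeff_bottom. simpl INR.
  rewrite Rmult_1_l; f_equal; lia.
- rewrite (Derive_ext _ _ _ IH), Derive_scal.
  rewrite (is_derive_unique _ _ _ (rodrigues_coeff_derive _ _ _)).
  rewrite minus_IZR, <- !INR_IZR_INZ.
  replace (Z.of_nat j - Z.of_nat n + 1)%Z
    with (Z.of_nat (S j) - Z.of_nat n)%Z by lia.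
  rewrite fact_simpl, mult_INR, S_INR. ring.
Qed.

Lemma legendre_Derive_n (n j : nat) (x : R) :
  Derive_n (legendre n) j x
  = INR (fact (n + j)) / (2 ^ n * INR (fact n))
    * rodrigues_coeff n (Z.of_nat j) x.
Proof.
revert x; induction j as [|j IH]; intros x; cbn [Derive_n].
- unfold legendre; rewrite rodrigues_Derive_n, Z.sub_diag, Nat.add_0_r.
  simpl (Z.of_nat 0). unfold Rdiv; ring.
- rewrite (Derive_ext _ _ _ IH), Derive_scal.
  rewrite (is_derive_unique _ _ _ (rodrigues_coeff_derive _ _ _)).
  rewrite <- !INR_IZR_INZ.
  replace (Z.of_nat j + 1)%Z with (Z.of_nat (S j)) by lia.
  rewrite Nat.add_succ_r, fact_simpl, mult_INR, S_INR, plus_INR.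
  unfold Rdiv; ring.
Qed.

Lemma assoc_legendre_polar (n : nat) (m : Z) (theta : R) :
  (Z.abs m <= Z.of_nat n)%Z -> 0 <= theta <= PI ->
  assoc_legendre n m (cos theta)
  = (-1) ^ Z.abs_nat m * factZ (Z.of_nat n + m) / (2 ^ n * INR (fact n))
    * polar_poly n m (cos theta) (sin theta).
Proof.
intros Hm Ht.
assert (Hc : (sin theta) ^ 2 = 1 - cos theta ^ 2).
{ pose proof (sin2_cos2 theta) as T; unfold Rsqr in T; simpl; lra. }
assert (Hnat : forall k, assoc_legendre_nat n k (cos theta)
  = (-1) ^ k * INR (fact (n + k)) / (2 ^ n * INR (fact n))
    * polar_poly n (Z.of_nat k) (cos theta) (sin theta)).
{ intros k. unfold assoc_legendre_nat.
  rewrite <- Hc, sqrt_pow2 by (apply sin_ge_0; lra).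
  rewrite legendre_Derive_n, polar_poly_rodrigues by exact Hc.
  unfold Rdiv; ring. }
unfold assoc_legendre, factZ. rewrite Hnat.
destruct (Z.leb_spec 0 m) as [P | N].
- replace (Z.of_nat (Z.abs_nat m)) with m by lia.
  replace (Z.to_nat (Z.of_nat n + m)) with (n + Z.abs_nat m)%nat by lia.
  reflexivity.
- replace (Z.to_nat (Z.of_nat n + m)) with (n - Z.abs_nat m)%nat by lia.
  replace (polar_poly n m) with (polar_poly n (- Z.of_nat (Z.abs_nat m)))
    by (f_equal; lia).
  rewrite polar_poly_opp.
  pose proof (INR_fact_neq_0 (n + Z.abs_nat m)).
  pose proof (INR_fact_neq_0 n).
  pose proof (pow_nonzero 2 n ltac:(lra)).
  field; auto.
Qed.

(** The normalization of [Y_angles], times the factor between [assoc_legendre]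
    and [polar_poly]. *)
Definition solid_norm (n : nat) (m : Z) : R :=
  sqrt ((2 * INR n + 1) / (4 * PI)
        * (factZ (Z.of_nat n - m) / factZ (Z.of_nat n + m)))
  * ((-1) ^ Z.abs_nat m * factZ (Z.of_nat n + m) / (2 ^ n * INR (fact n))).

Lemma factZ_pos (j : Z) : 0 < factZ j.
Proof. apply lt_0_INR, lt_O_fact. Qed.

Lemma solid_norm_sqr (n : nat) (m : Z) :
  (Z.abs m <= Z.of_nat n)%Z ->
  solid_norm n m ^ 2 * (2 * PI * polar_inner n n m) = 1.
Proof.
intros Hm. pose proof (polar_inner_norm n m Hm) as HI.
pose proof (factZ_pos (Z.of_nat n - m)) as F1.
pose proof (factZ_pos (Z.of_nat n + m)) as F2.
pose proof (INR_fact_neq_0 n) as F3.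
pose proof PI_RGT_0 as HP; pose proof (pos_INR n) as Hn.
pose proof (pow_nonzero 2 n ltac:(lra)) as H2.
unfold solid_norm. rewrite !Rpow_mult_distr, pow2_sqrt.
2: { apply Rmult_le_pos; apply Rlt_le, Rdiv_lt_0_compat; lra. }
unfold Rdiv; rewrite !Rpow_mult_distr, <- pow_mult.
rewrite (Nat.mul_comm (Z.abs_nat m)), pow_1_even.
replace (4 ^ n) with ((2 ^ n) ^ 2) in HI
  by (rewrite <- pow_mult, Nat.mul_comm, pow_mult; f_equal; ring).
assert (E : polar_inner n n m = 2 * (2 ^ n) ^ 2 * INR (fact n) ^ 2
            / (factZ (Z.of_nat n - m) * factZ (Z.of_nat n + m)
               * (2 * INR n + 1))).
{ rewrite <- HI. field. repeat split; lra. }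
rewrite E. field. repeat split; lra.
Qed.

(** Valid for every vector, with the angles that [Y] itself chooses: this
    covers the value of [Y] at zero, needed for [solid] at the origin. *)
Lemma Y_solid_poly (n : nat) (m : Z) (xi : R3) :
  (Z.abs m <= Z.of_nat n)%Z ->
  Y n m xi = (solid_norm n m
              * solid_poly n m (spherical (polar xi) (azimuth xi)))%C.
Proof.
intros Hm. unfold Y, Y_angles.
rewrite assoc_legendre_polar by (exact Hm || apply acos_bound).
rewrite solid_poly_spherical. unfold solid_norm. rewrite !RtoC_mult. ring.
Qed.

Lemma solid_solid_poly (n : nat) (m : Z) (x : R3) :
  (Z.abs m <= Z.of_nat n)%Z ->
  solid n m x = (solid_norm n m * solid_poly n m x)%C.
Proof.
intros Hm. unfold solid. rewrite Y_solid_poly, RtoC_pow by exact Hm.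
set (xi := spherical _ _).
transitivity (solid_norm n m * (enorm x ^ n * solid_poly n m xi))%C; [ring |].
rewrite <- solid_poly_scal. do 2 f_equal. unfold xi; clear xi.
destruct (Req_dec (enorm x) 0) as [Z0 | N0].
- rewrite Z0, (enorm_zero_eq x Z0). R3_ring.
- rewrite spherical_angles.
  + unfold unit_vec. rewrite scal_assoc. unfold mult; simpl.
    rewrite Rinv_r by exact N0. apply (scal_one (K := R_Ring)).
  + unfold unit_vec. rewrite enorm_scal.
    pose proof (enorm_ge_0 x).
    rewrite Rabs_pos_eq; [now apply Rinv_l |].
    apply Rlt_le, Rinv_0_lt_compat; lra.
Qed.

Lemma Y_unit (n : nat) (m : Z) (xi : R3) :
  (Z.abs m <= Z.of_nat n)%Z -> enorm xi = 1 ->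
  Y n m xi = (solid_norm n m * solid_poly n m xi)%C.
Proof.
intros Hm Hx. now rewrite Y_solid_poly, spherical_angles.
Qed.

(** * Complex integrals *)

Notation is_CInt := (is_RInt (V := C_R_NormedModule)).

Lemma norm_C_R (z : C) : norm (z : C_R_NormedModule) = Cmod z.
Proof.
unfold norm; simpl; unfold prod_norm, Cmod; f_equal.
unfold norm; simpl; unfold abs; simpl.
rewrite !Rmult_1_r, <- !Rabs_mult, !Rabs_pos_eq by nra. reflexivity.
Qed.

Lemma is_CInt_pair (f : R -> C) (a b : R) (l : C) :
  is_RInt (fun t => Re (f t)) a b (Re l) ->
  is_RInt (fun t => Im (f t)) a b (Im l) -> is_CInt f a b l.
Proof.
intros H1 H2. rewrite (surjective_pairing l).
exact (@is_RInt_fct_extend_pair R_NormedModule R_NormedModule f a b _ _ H1 H2).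
Qed.

Lemma is_CInt_Re (f : R -> C) (a b : R) (l : C) :
  is_CInt f a b l -> is_RInt (fun t => Re (f t)) a b (Re l).
Proof.
exact (@is_RInt_fct_extend_fst R_NormedModule R_NormedModule f a b l).
Qed.

Lemma is_CInt_Im (f : R -> C) (a b : R) (l : C) :
  is_CInt f a b l -> is_RInt (fun t => Im (f t)) a b (Im l).
Proof.
exact (@is_RInt_fct_extend_snd R_NormedModule R_NormedModule f a b l).
Qed.

Lemma is_CInt_mult_l (c : C) (f : R -> C) (a b : R) (l : C) :
  is_CInt f a b l -> is_CInt (fun t => c * f t)%C a b (c * l)%C.
Proof.
intros H. apply is_CInt_pair; simpl.
- apply (is_RInt_minus (V := R_NormedModule));
  apply (is_RInt_scal (V := R_NormedModule));
  [apply (is_CInt_Re _ _ _ _ H) | apply (is_CInt_Im _ _ _ _ H)].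
- apply (is_RInt_plus (V := R_NormedModule));
  apply (is_RInt_scal (V := R_NormedModule));
  [apply (is_CInt_Im _ _ _ _ H) | apply (is_CInt_Re _ _ _ _ H)].
Qed.

Lemma is_CInt_plus (f g : R -> C) (a b : R) (lf lg : C) :
  is_CInt f a b lf -> is_CInt g a b lg ->
  is_CInt (fun t => f t + g t)%C a b (lf + lg)%C.
Proof. exact (is_RInt_plus (V := C_R_NormedModule) f g a b lf lg). Qed.

Lemma is_CInt_RtoC (f : R -> R) (a b l : R) :
  is_RInt f a b l -> is_CInt (fun t => RtoC (f t)) a b (RtoC l).
Proof.
intros H; apply is_CInt_pair; simpl; [exact H |].
evar_last; [apply @is_RInt_const |].
unfold scal; simpl; unfold mult; simpl; ring.
Qed.

Lemma is_CInt_ext (f g : R -> C) (a b : R) (l : C) :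
  (forall t, f t = g t) -> is_CInt f a b l -> is_CInt g a b l.
Proof. intros H; apply is_RInt_ext; intros; apply H. Qed.

Lemma is_CInt_unique (f : R -> C) (a b : R) (l l' : C) :
  is_CInt f a b l -> is_CInt f a b l' -> l = l'.
Proof.
intros H H'.
apply (is_RInt_unique (V := C_R_CompleteNormedModule)) in H, H'.
congruence.
Qed.

Lemma is_CInt_bound (f : R -> C) (a b : R) (l : C) (M : R) :
  a <= b -> (forall t, Cmod (f t) <= M) -> is_CInt f a b l ->
  Cmod l <= (b - a) * M.
Proof.
intros Hab HM H. rewrite <- norm_C_R.
apply (norm_RInt_le_const (V := C_R_NormedModule) f a b l M Hab); [| exact H].
intros t _; rewrite norm_C_R; apply HM.
Qed.

Lemma cos_sin_period_Z (j : Z) :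
  cos (IZR j * (2 * PI)) = 1 /\ sin (IZR j * (2 * PI)) = 0.
Proof.
assert (H : forall k : nat,
  cos (IZR (Z.of_nat k) * (2 * PI)) = 1
  /\ sin (IZR (Z.of_nat k) * (2 * PI)) = 0).
{ intros k. rewrite <- INR_IZR_INZ.
  replace (INR k * (2 * PI)) with (0 + 2 * INR k * PI) by ring.
  now rewrite cos_period, sin_period, cos_0, sin_0. }
destruct (Z.leb_spec 0 j) as [P | N].
- rewrite <- (Z2Nat.id j P). apply H.
- destruct (H (Z.to_nat (- j))) as [Hc Hs].
  rewrite Z2Nat.id in Hc, Hs by lia.
  rewrite opp_IZR, <- Ropp_mult_distr_l, cos_neg in Hc.
  rewrite opp_IZR, <- Ropp_mult_distr_l, sin_neg in Hs.
  split; lra.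
Qed.

Lemma Cexp_i_CInt (j : Z) :
  is_CInt (fun phi => Cexp_i (IZR j * phi)) 0 (2 * PI)
    (if (j =? 0)%Z then RtoC (2 * PI) else RtoC 0).
Proof.
destruct (Z.eqb_spec j 0) as [-> | N].
- apply is_CInt_ext with (fun _ => RtoC 1).
  + intros t. unfold Cexp_i. now rewrite Rmult_0_l, cos_0, sin_0.
  + apply is_CInt_RtoC. evar_last; [apply @is_RInt_const |].
    unfold scal; simpl; unfold mult; simpl; ring.
- assert (Nz : IZR j <> 0) by (intros E; apply N, eq_IZR, E).
  destruct (cos_sin_period_Z j) as [Hc Hs].
  apply is_CInt_pair; simpl.
  + evar_last.
    * apply (is_RInt_derive (V := R_CompleteNormedModule)
               (fun x => sin (IZR j * x) / IZR j)).
      -- intros x _; auto_derive; [auto | now field].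
      -- intros x _; apply (ex_derive_continuous (V := R_NormedModule));
         auto_derive; auto.
    * rewrite Hs, Rmult_0_r, sin_0. unfold minus, plus, opp; simpl; field; auto.
  + evar_last.
    * apply (is_RInt_derive (V := R_CompleteNormedModule)
               (fun x => - cos (IZR j * x) / IZR j)).
      -- intros x _; auto_derive; [auto | now field].
      -- intros x _; apply (ex_derive_continuous (V := R_NormedModule));
         auto_derive; auto.
    * rewrite Hc, Rmult_0_r, cos_0. unfold minus, plus, opp; simpl; field; auto.
Qed.

(** * Integrals over the sphere *)

(** [sphere_int] with the existence of both iterated integrals. *)
Definition is_sphere_int (g : R3 -> C) (l : C) : Prop :=
  exists I : R -> C,
    (forall theta, is_CInt (fun phi => sin theta * g (spherical theta phi))%C
                     0 (2 * PI) (I theta))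
    /\ is_CInt I 0 PI l.

Lemma is_sphere_int_unique (g : R3 -> C) (l : C) :
  is_sphere_int g l -> sphere_int g = l.
Proof.
intros [I [H1 H2]]. unfold sphere_int.
apply (is_RInt_unique (V := C_R_CompleteNormedModule)).
revert H2; apply (is_RInt_ext (V := C_R_NormedModule)); intros th _.
symmetry; apply (is_RInt_unique (V := C_R_CompleteNormedModule)), H1.
Qed.

Lemma enorm_spherical (theta phi : R) : enorm (spherical theta phi) = 1.
Proof.
unfold enorm, spherical, vec, px, py, pz; simpl.
replace 1 with (sqrt 1) at 4 by apply sqrt_1. f_equal.
pose proof (sin2_cos2 theta) as T1; pose proof (sin2_cos2 phi) as T2.
unfold Rsqr in *.
transitivity (sin theta * sin theta * (sin phi * sin phi + cos phi * cos phi)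
              + cos theta * cos theta); [ring |].
rewrite T2; lra.
Qed.

Lemma is_sphere_int_ext (g h : R3 -> C) (l : C) :
  (forall xi, enorm xi = 1 -> g xi = h xi) ->
  is_sphere_int g l -> is_sphere_int h l.
Proof.
intros E [I [H1 H2]]. exists I; split; [| exact H2].
intros th. eapply is_CInt_ext; [| apply H1].
intros ph; cbn beta. rewrite E; [reflexivity | apply enorm_spherical].
Qed.

Lemma is_sphere_int_mult_l (c : C) (g : R3 -> C) (l : C) :
  is_sphere_int g l -> is_sphere_int (fun xi => c * g xi)%C (c * l)%C.
Proof.
intros [I [H1 H2]]. exists (fun th => c * I th)%C; split.
- intros th. eapply is_CInt_ext; [| apply is_CInt_mult_l, H1].
  intros ph; cbn beta; ring.
- now apply is_CInt_mult_l.
Qed.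

Lemma is_sphere_int_plus (g h : R3 -> C) (lg lh : C) :
  is_sphere_int g lg -> is_sphere_int h lh ->
  is_sphere_int (fun xi => g xi + h xi)%C (lg + lh)%C.
Proof.
intros [I [H1 H2]] [J [K1 K2]]. exists (fun th => I th + J th)%C; split.
- intros th. eapply is_CInt_ext; [| apply is_CInt_plus; [apply H1 | apply K1]].
  intros ph; cbn beta; ring.
- now apply is_CInt_plus.
Qed.

Lemma is_sphere_int_Csum (g : nat -> R3 -> C) (l : nat -> C) (n : nat) :
  (forall k, (k <= n)%nat -> is_sphere_int (g k) (l k)) ->
  is_sphere_int (fun xi => Csum (fun k => g k xi) n) (Csum l n).
Proof.
induction n as [|n IH]; intros H.
- rewrite Csum_O. apply is_sphere_int_ext with (g 0%nat); [| now apply H].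
  intros; now rewrite Csum_O.
- rewrite Csum_S.
  apply is_sphere_int_ext
    with (fun xi => Csum (fun k => g k xi) n + g (S n) xi)%C.
  + intros; now rewrite Csum_S.
  + apply is_sphere_int_plus; [apply IH; auto | now apply H].
Qed.

(** The two iterated integrals pass to a uniform limit one after the other. *)
Lemma is_sphere_int_uniform_limit (gN : nat -> R3 -> C) (g : R3 -> C)
    (lN : nat -> C) (l : C) (N0 : nat) :
  (forall N, is_sphere_int (gN N) (lN N)) ->
  (forall eps, 0 < eps -> exists N1, forall N, (N1 <= N)%nat ->
     forall xi, enorm xi = 1 -> Cmod (gN N xi - g xi) <= eps) ->
  (forall N, (N0 <= N)%nat -> lN N = l) ->
  is_sphere_int g l.
Proof.
intros HN HU Hl.
set (IN := fun N th => RInt (V := C_R_CompleteNormedModule)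
   (fun phi => sin th * gN N (spherical th phi))%C 0 (2 * PI)).
assert (H1 : forall N th,
  is_CInt (fun phi => sin th * gN N (spherical th phi))%C 0 (2 * PI) (IN N th)).
{ intros N th. destruct (HN N) as [I [HI _]].
  apply (RInt_correct (V := C_R_CompleteNormedModule)). eexists; apply HI. }
assert (H2 : forall N, is_CInt (IN N) 0 PI (lN N)).
{ intros N. destruct (HN N) as [I [HI HJ]].
  eapply is_CInt_ext; [| exact HJ]. intros th.
  apply (is_CInt_unique _ _ _ _ _ (HI th) (H1 N th)). }
assert (HP := PI_RGT_0).
assert (Hsin : forall th z, Cmod (sin th * z) <= Cmod z).
{ intros th z. rewrite Cmod_mult, Cmod_R.
  rewrite <- (Rmult_1_l (Cmod z)) at 2.
  apply Rmult_le_compat_r; [apply Cmod_ge_0 |].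
  apply Rabs_le, SIN_bound. }
assert (H3 : forall th, exists l',
  is_CInt (fun phi => sin th * g (spherical th phi))%C 0 (2 * PI) l').
{ intros th.
  destruct (filterlim_RInt (V := C_R_CompleteNormedModule)
     (fun N phi => sin th * gN N (spherical th phi))%C 0 (2 * PI) eventually _
     (fun phi => sin th * g (spherical th phi))%C (fun N => IN N th))
    as [l' [_ Hint]].
  - intros N; apply H1.
  - apply filterlim_locally; intros eps.
    destruct (HU (eps / 2)) as [N1 HN1]; [apply is_pos_div_2 |].
    exists N1; intros N HNN phi. apply C_NormedModule_mixin_compat1.
    change (Cmod (sin th * gN N (spherical th phi)
                  - sin th * g (spherical th phi))%C < eps).
    replace (_ - _)%C
      with (sin th * (gN N (spherical th phi) - g (spherical th phi)))%C
      by ring.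
    eapply Rle_lt_trans; [apply Hsin |].
    eapply Rle_lt_trans; [apply HN1; [exact HNN | apply enorm_spherical] |].
    pose proof (cond_pos eps); lra.
  - exists l'; exact Hint. }
set (I := fun th => RInt (V := C_R_CompleteNormedModule)
   (fun phi => sin th * g (spherical th phi))%C 0 (2 * PI)).
assert (H4 : forall th,
  is_CInt (fun phi => sin th * g (spherical th phi))%C 0 (2 * PI) (I th)).
{ intros th. destruct (H3 th) as [l' HI].
  apply (RInt_correct (V := C_R_CompleteNormedModule)). eexists; apply HI. }
destruct (filterlim_RInt (V := C_R_CompleteNormedModule) IN 0 PI
  eventually _ I lN) as [l' [Hlim Hint]].
- exact H2.
- apply filterlim_locally; intros eps.
  destruct (HU (eps / (4 * PI))) as [N1 HN1].
  { apply Rdiv_lt_0_compat; [apply cond_pos | lra]. }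
  exists N1; intros N HNN th. apply C_NormedModule_mixin_compat1.
  assert (Hd : is_CInt (fun phi => sin th * gN N (spherical th phi)
      + (- (1)) * (sin th * g (spherical th phi)))%C
      0 (2 * PI) (IN N th + (- (1)) * I th)%C).
  { apply is_CInt_plus; [apply H1 | apply is_CInt_mult_l, H4]. }
  change (Cmod (IN N th - I th)%C < eps).
  replace (_ - _)%C with (IN N th + (- (1)) * I th)%C by ring.
  eapply Rle_lt_trans.
  { refine (is_CInt_bound _ 0 (2 * PI) _ (eps / (4 * PI)) _ _ Hd); [lra |].
    intros phi.
    replace (_ + _)%C
      with (sin th * (gN N (spherical th phi) - g (spherical th phi)))%C
      by ring.
    eapply Rle_trans; [apply Hsin |].
    apply HN1; [exact HNN | apply enorm_spherical]. }
  replace ((2 * PI - 0) * (eps / (4 * PI))) with (eps / 2) by (field; lra).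
  pose proof (cond_pos eps); lra.
- assert (E : l' = l).
  { apply (filterlim_locally_unique (V := C_R_NormedModule)
             (F := eventually) lN); [exact Hlim |].
    apply filterlim_ext_loc with (fun _ => l); [| apply filterlim_const].
    exists N0; intros; symmetry; auto. }
  subst l'. exists I; split; assumption.
Qed.

(** The azimuthal integral separates the orders, the polar one the degrees. *)
Lemma solid_poly_inner (k n : nat) (m' m : Z) :
  is_sphere_int (fun xi => solid_poly k m' xi * Cconj (solid_poly n m xi))%C
    (if andb (k =? n)%nat (m' =? m)%Z then RtoC (2 * PI * polar_inner n n m)
     else RtoC 0).
Proof.
exists (fun th => (sin th * (polar_poly k m' (cos th) (sin th)
                   * polar_poly n m (cos th) (sin th)))
          * (if (m' - m =? 0)%Z then RtoC (2 * PI) else RtoC 0))%C.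
split.
- intros th.
  eapply is_CInt_ext; [| apply is_CInt_mult_l, (Cexp_i_CInt (m' - m))].
  intros ph; cbn beta.
  rewrite !solid_poly_spherical, Cmult_conj, Cexp_i_conj.
  replace (Cconj (polar_poly n m (cos th) (sin th)))
    with (RtoC (polar_poly n m (cos th) (sin th)))
    by (unfold Cconj, RtoC; simpl; f_equal; ring).
  replace (IZR (m' - m) * ph) with (IZR m' * ph + - (IZR m * ph))
    by (rewrite minus_IZR; ring).
  rewrite Cexp_i_plus; ring.
- destruct (Z.eqb_spec (m' - m) 0) as [E | N].
  + replace m' with m by lia. rewrite Z.eqb_refl, Bool.andb_true_r.
    assert (H : is_CInt
        (fun th => RtoC (2 * PI) * RtoC (polar_product k n m th))%C
        0 PI (RtoC (2 * PI) * polar_inner k n m)%C)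
      by apply is_CInt_mult_l, is_CInt_RtoC, polar_product_RInt.
    destruct (Nat.eqb_spec k n) as [-> | Nk].
    * cbv iota. rewrite (RtoC_mult (2 * PI)).
      revert H; apply is_CInt_ext; intros th.
      unfold polar_product; rewrite !RtoC_mult; ring.
    * rewrite polar_inner_orthogonal, Cmult_0_r in H by exact Nk.
      revert H; apply is_CInt_ext; intros th.
      unfold polar_product; rewrite !RtoC_mult; ring.
  + replace (andb (k =? n)%nat (m' =? m)%Z) with false.
    2: { symmetry; apply Bool.andb_false_intro2, Z.eqb_neq; lia. }
    eapply is_CInt_ext with (fun _ => RtoC 0); [intros; ring |].
    apply is_CInt_RtoC. evar_last; [apply @is_RInt_const |].
    unfold scal; simpl; unfold mult; simpl; ring.
Qed.

(** * Local coefficients of a convergent expansion *)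

Definition solid_sum (a : nat -> Z -> C) (N : nat) (x : R3) : C :=
  Csum (fun k => sum_orders k (fun m => a k m * solid_poly k m x)%C) N.

(** Uniform convergence on one sphere, which is all that the local
    coefficients see. *)
Definition sphere_expansion (a : nat -> Z -> C) (f : R3 -> C) (c : R3)
    (rho : R) : Prop :=
  forall eps, 0 < eps -> exists N1, forall N, (N1 <= N)%nat ->
    forall xi, enorm xi = 1 ->
    Cmod (solid_sum a N (scal rho xi) - f (plus c (scal rho xi))) <= eps.

(** A partial sum reaching the degree [n] already has the full coefficient, so
    that the limit over [N] below is that of an eventually constant sequence. *)
Lemma solid_sum_inner (a : nat -> Z -> C) (rho : R) (N n : nat) (m : Z) :
  (Z.abs m <= Z.of_nat n)%Z ->
  is_sphere_int
    (fun xi => solid_sum a N (scal rho xi) * Cconj (solid_poly n m xi))%C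
    (if (n <=? N)%nat
     then (a n m * rho ^ n * (2 * PI * polar_inner n n m)%R)%C else RtoC 0).
Proof.
intros Hm.
set (l := fun k m' => ((a k m' * rho ^ k)
   * (if andb (k =? n)%nat (m' =? m)%Z then RtoC (2 * PI * polar_inner n n m)
      else RtoC 0))%C).
assert (H : is_sphere_int (fun xi => Csum (fun k => sum_orders k (fun m' =>
    (a k m' * rho ^ k) * (solid_poly k m' xi * Cconj (solid_poly n m xi))))%C N)
  (Csum (fun k => sum_orders k (l k)) N)).
{ apply (is_sphere_int_Csum (fun k xi => sum_orders k (fun m' =>
    (a k m' * rho ^ k) * (solid_poly k m' xi * Cconj (solid_poly n m xi))))%C).
  intros k _.
  apply (is_sphere_int_Csum (fun j xi => (fun m' =>
    (a k m' * rho ^ k) * (solid_poly k m' xi * Cconj (solid_poly n m xi)))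
    (Z.of_nat j - Z.of_nat k)%Z)%C).
  intros j _. apply is_sphere_int_mult_l, solid_poly_inner. }
match type of H with is_sphere_int _ ?s =>
  match goal with |- is_sphere_int _ ?t => replace t with s end end.
- revert H; apply is_sphere_int_ext; intros xi _.
  unfold solid_sum. rewrite <- Csum_mult_r. apply Csum_ext.
  intros k _. rewrite Cmult_comm, sum_orders_mult_l.
  apply sum_orders_ext; intros m' _. rewrite solid_poly_scal; ring.
- destruct (Nat.leb_spec n N) as [Hn | Hn].
  + rewrite (Csum_single _ N n Hn).
    * rewrite (sum_orders_single n _ m Hm).
      -- unfold l. now rewrite Nat.eqb_refl, Z.eqb_refl.
      -- intros m' _ Nm. unfold l. rewrite (proj2 (Z.eqb_neq m' m) Nm).
         rewrite Bool.andb_false_r; ring.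
    * intros k _ Nk. apply sum_orders_zero; intros m' _.
      unfold l. rewrite (proj2 (Nat.eqb_neq k n) Nk). simpl; ring.
  + apply Csum_zero; intros k Hk. apply sum_orders_zero; intros m' _.
    unfold l. rewrite (proj2 (Nat.eqb_neq k n)) by lia. simpl; ring.
Qed.

(** By orthogonality only the term of degree [n] and order [m] survives, and
    [solid_norm_sqr] normalizes it. *)
Lemma local_coeff_expansion (a : nat -> Z -> C) (f : R3 -> C) (c : R3)
    (rho : R) (n : nat) (m : Z) :
  0 < rho -> sphere_expansion a f c rho -> (Z.abs m <= Z.of_nat n)%Z ->
  (local_coeff f c rho n m * solid_norm n m)%C = a n m.
Proof.
intros Hrho He Hm. unfold local_coeff.
assert (Hint : is_sphere_int
  (fun xi => f (plus c (scal rho xi)) * Cconj (Y n m xi))%C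
  (solid_norm n m * (a n m * rho ^ n * (2 * PI * polar_inner n n m)%R))%C).
{ apply is_sphere_int_ext with
    (fun xi => solid_norm n m
       * (f (plus c (scal rho xi)) * Cconj (solid_poly n m xi)))%C.
  { intros xi Hxi. rewrite Y_unit by assumption. rewrite Cmult_conj.
    replace (Cconj (solid_norm n m)) with (RtoC (solid_norm n m))
      by (unfold Cconj, RtoC; simpl; f_equal; ring). ring. }
  apply is_sphere_int_mult_l.
  apply is_sphere_int_uniform_limit with
    (gN := fun N xi =>
       (solid_sum a N (scal rho xi) * Cconj (solid_poly n m xi))%C)
    (lN := fun N => if (n <=? N)%nat
       then (a n m * rho ^ n * (2 * PI * polar_inner n n m)%R)%C else RtoC 0)
    (N0 := n).
  - intros N; now apply solid_sum_inner.
  - intros eps Heps.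
    assert (H4 : 0 < 4 ^ n) by (apply pow_lt; lra).
    destruct (He (eps / 4 ^ n)) as [N1 HN1]; [now apply Rdiv_lt_0_compat |].
    exists N1; intros N HN xi Hxi.
    replace (_ - _)%C
      with ((solid_sum a N (scal rho xi) - f (plus c (scal rho xi)))
            * Cconj (solid_poly n m xi))%C by ring.
    rewrite Cmod_mult, Cmod_conj.
    replace eps with (eps / 4 ^ n * 4 ^ n) by (field; lra).
    apply Rmult_le_compat; try apply Cmod_ge_0.
    + now apply HN1.
    + now apply solid_poly_bound.
  - intros N HN. now rewrite (proj2 (Nat.leb_le n N) HN). }
rewrite (is_sphere_int_unique _ _ Hint).
assert (Hr : RtoC (rho ^ n) <> 0).
{ intros E; apply RtoC_inj in E. revert E; apply pow_nonzero; lra. }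
rewrite RtoC_inv by (intros E; apply Hr; now rewrite E).
rewrite <- RtoC_pow.
transitivity (a n m * (/ (rho ^ n)%R * (rho ^ n)%R)
  * (solid_norm n m * solid_norm n m * (2 * PI * polar_inner n n m)%R))%C;
  [ring |].
rewrite Cinv_l by exact Hr.
rewrite <- !RtoC_mult.
replace (solid_norm n m * solid_norm n m * (2 * PI * polar_inner n n m))
  with (solid_norm n m ^ 2 * (2 * PI * polar_inner n n m)) by ring.
rewrite solid_norm_sqr by exact Hm. ring.
Qed.

Lemma local_expansion_solid_sum (p : nat) (a : nat -> Z -> C) (f : R3 -> C)
    (c x : R3) (rho : R) :
  0 < rho -> sphere_expansion a f c rho ->
  local_expansion p c rho f x = solid_sum a p (minus x c).
Proof.
intros Hrho He. apply Csum_ext; intros n _; apply Csum_ext; intros k Hk.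
rewrite solid_solid_poly by lia.
rewrite <- (local_coeff_expansion a f c rho n _ Hrho He) by lia. ring.
Qed.

(** * Means over a circle of null directions *)

(** Continuity by components, the form in which complex integrals are reduced
    to real ones. *)
Definition C_continuous (f : R -> C) : Prop :=
  forall t,
    continuous (fun s => Re (f s)) t /\ continuous (fun s => Im (f s)) t.

Lemma C_continuous_pair (f g : R -> R) :
  (forall t, continuous f t) -> (forall t, continuous g t) ->
  C_continuous (fun t => (f t, g t)).
Proof. intros Hf Hg t; split; [apply Hf | apply Hg]. Qed.

Lemma C_continuous_const (c : C) : C_continuous (fun _ => c).
Proof. intros t; split; apply continuous_const. Qed.

Lemma C_continuous_plus (f g : R -> C) :
  C_continuous f -> C_continuous g -> C_continuous (fun t => f t + g t)%C.
Proof.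
intros Hf Hg t; destruct (Hf t), (Hg t); split;
  now apply (continuous_plus (V := R_NormedModule)).
Qed.

Lemma C_continuous_mult (f g : R -> C) :
  C_continuous f -> C_continuous g -> C_continuous (fun t => f t * g t)%C.
Proof.
intros Hf Hg t; destruct (Hf t), (Hg t); split.
- apply (continuous_minus (V := R_NormedModule));
  now apply (continuous_mult (K := R_AbsRing)).
- apply (continuous_plus (V := R_NormedModule));
  now apply (continuous_mult (K := R_AbsRing)).
Qed.

Lemma C_continuous_opp (f : R -> C) :
  C_continuous f -> C_continuous (fun t => - f t)%C.
Proof.
intros Hf t; destruct (Hf t); split;
  now apply (continuous_opp (V := R_NormedModule)).
Qed.

Lemma C_continuous_minus (f g : R -> C) :
  C_continuous f -> C_continuous g -> C_continuous (fun t => f t - g t)%C.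
Proof. intros Hf Hg; apply C_continuous_plus, C_continuous_opp; assumption. Qed.

Lemma C_continuous_pow (f : R -> C) (n : nat) :
  C_continuous f -> C_continuous (fun t => f t ^ n)%C.
Proof.
intros Hf; induction n as [|n IH]; [apply (C_continuous_const 1) |].
now apply C_continuous_mult.
Qed.

Lemma C_continuous_inv (f : R -> C) :
  C_continuous f -> (forall t, f t <> 0) -> C_continuous (fun t => / f t)%C.
Proof.
intros Hf Hn t; destruct (Hf t) as [H1 H2].
assert (Hd : fst (f t) ^ 2 + snd (f t) ^ 2 <> 0).
{ intros E. apply (Hn t). rewrite (surjective_pairing (f t)).
  unfold RtoC; f_equal; nra. }
assert (Hc : continuous (fun s => / (fst (f s) ^ 2 + snd (f s) ^ 2)) t).
{ apply (continuous_comp (fun s => fst (f s) ^ 2 + snd (f s) ^ 2) Rinv).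
  - apply (continuous_plus (V := R_NormedModule));
      apply (continuous_mult (K := R_AbsRing)); try assumption;
      apply (continuous_mult (K := R_AbsRing)); try assumption;
      apply continuous_const.
  - now apply continuous_Rinv. }
split; simpl; apply (continuous_mult (K := R_AbsRing)); try assumption.
now apply (continuous_opp (V := R_NormedModule)).
Qed.

Lemma C_continuous_Csum (f : nat -> R -> C) (n : nat) :
  (forall k, C_continuous (f k)) ->
  C_continuous (fun t => Csum (fun k => f k t) n).
Proof.
intros H; induction n as [|n IH]; intros t.
- destruct (H 0%nat t); split.
  + apply continuous_ext with (fun s => Re (f 0%nat s)); [| assumption].
    intros; now rewrite Csum_O.
  + apply continuous_ext with (fun s => Im (f 0%nat s)); [| assumption].
    intros; now rewrite Csum_O.
- destruct (C_continuous_plus _ _ IH (H (S n)) t) as [H1 H2]; split.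
  + revert H1; apply continuous_ext; intros; now rewrite Csum_S.
  + revert H2; apply continuous_ext; intros; now rewrite Csum_S.
Qed.

Definition mean (f : R -> C) : C :=
  (RtoC (/ (2 * PI)) * RInt (V := C_R_CompleteNormedModule) f 0 (2 * PI))%C.

Lemma two_PI_neq_0 : 2 * PI <> 0.
Proof. pose proof PI_RGT_0; lra. Qed.

Lemma mean_correct (f : R -> C) :
  C_continuous f -> is_CInt f 0 (2 * PI) (RtoC (2 * PI) * mean f)%C.
Proof.
intros Hf. unfold mean.
rewrite Cmult_assoc, <- RtoC_mult, Rinv_r, Cmult_1_l by apply two_PI_neq_0.
apply (RInt_correct (V := C_R_CompleteNormedModule)).
exists (RInt (fun t => Re (f t)) 0 (2 * PI),
        RInt (fun t => Im (f t)) 0 (2 * PI)).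
apply is_CInt_pair; cbn [Re Im fst snd];
  apply (RInt_correct (V := R_CompleteNormedModule)),
    (ex_RInt_continuous (V := R_CompleteNormedModule));
  intros z _; destruct (Hf z); assumption.
Qed.

Lemma mean_unique (f : R -> C) (l : C) :
  is_CInt f 0 (2 * PI) (RtoC (2 * PI) * l)%C -> mean f = l.
Proof.
intros H. unfold mean.
rewrite (is_RInt_unique (V := C_R_CompleteNormedModule) _ _ _ _ H).
now rewrite Cmult_assoc, <- RtoC_mult, Rinv_l, Cmult_1_l by apply two_PI_neq_0.
Qed.

Lemma mean_ext (f g : R -> C) : (forall t, f t = g t) -> mean f = mean g.
Proof.
intros H. unfold mean; f_equal.
apply (RInt_ext (V := C_R_CompleteNormedModule)); intros; apply H.
Qed.

Lemma mean_mult_r (f : R -> C) (c : C) :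
  C_continuous f -> mean (fun t => f t * c)%C = (mean f * c)%C.
Proof.
intros Hf; apply mean_unique.
replace (_ * _)%C with (c * (RtoC (2 * PI) * mean f))%C by ring.
eapply is_CInt_ext; [| apply is_CInt_mult_l, mean_correct, Hf].
intros; cbn beta; ring.
Qed.

Lemma mean_plus (f g : R -> C) :
  C_continuous f -> C_continuous g ->
  mean (fun t => f t + g t)%C = (mean f + mean g)%C.
Proof.
intros Hf Hg; apply mean_unique.
rewrite Cmult_plus_distr_l. now apply is_CInt_plus; apply mean_correct.
Qed.

Lemma mean_minus (f g : R -> C) :
  C_continuous f -> C_continuous g ->
  mean (fun t => f t - g t)%C = (mean f - mean g)%C.
Proof.
intros Hf Hg.
replace (mean f - mean g)%C with (mean f + mean g * (- (1)))%C by ring.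
rewrite <- mean_mult_r, <- mean_plus by first [assumption
  | apply C_continuous_mult; [assumption | apply C_continuous_const]].
apply mean_ext; intros; ring.
Qed.

Lemma mean_Csum (f : nat -> R -> C) (n : nat) :
  (forall k, C_continuous (f k)) ->
  mean (fun t => Csum (fun k => f k t) n) = Csum (fun k => mean (f k)) n.
Proof.
intros H; induction n as [|n IH].
- rewrite Csum_O; apply mean_ext; intros; now rewrite Csum_O.
- rewrite Csum_S, <- IH.
  rewrite <- (mean_plus _ _ (C_continuous_Csum f n H) (H (S n))).
  apply mean_ext; intros; now rewrite Csum_S.
Qed.

Lemma mean_bound (f : R -> C) (M : R) :
  C_continuous f -> (forall t, Cmod (f t) <= M) -> Cmod (mean f) <= M.
Proof.
intros Hf HM. pose proof PI_RGT_0 as HP.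
pose proof (is_CInt_bound f 0 (2 * PI) _ M ltac:(lra) HM
              (mean_correct f Hf)) as H.
rewrite Cmod_mult, Cmod_R, Rabs_pos_eq in H by lra.
apply Rmult_le_reg_l with (2 * PI); lra.
Qed.

(** In vector notation, [e + i (u cos t + v sin t)]. *)
Definition null_circle (e u v : R3) (t : R) : C3 :=
  mkC3 (px e, px u * cos t + px v * sin t) (py e, py u * cos t + py v * sin t)
       (pz e, pz u * cos t + pz v * sin t).

Definition orthonormal (e u v : R3) : Prop :=
  rdot e e = 1 /\ rdot u u = 1 /\ rdot v v = 1 /\
  rdot e u = 0 /\ rdot e v = 0 /\ rdot u v = 0 /\
  forall x, rdot x e ^ 2 + rdot x u ^ 2 + rdot x v ^ 2 = enorm x ^ 2.

(** The third vector of the frame is the cross product of the first two;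
    Parseval's identity is then the expansion of a Gram determinant. *)
Lemma orthonormal_exists (e : R3) :
  rdot e e = 1 -> exists u v, orthonormal e u v.
Proof.
intros He.
assert (Hu : exists u, rdot u u = 1 /\ rdot e u = 0).
{ destruct (Req_dec (px e ^ 2 + py e ^ 2) 0) as [E0 | N0].
  - exists (vec 1 0 0). unfold rdot, vec, px, py, pz in *; simpl in *. nra.
  - set (k := sqrt (px e ^ 2 + py e ^ 2)).
    assert (Hk : k * k = px e ^ 2 + py e ^ 2) by (apply sqrt_sqrt; nra).
    assert (Nk : k <> 0) by (intros E; rewrite E in Hk; lra).
    exists (vec (- py e / k) (px e / k) 0).
    unfold rdot, vec, px, py, pz in *; simpl in *. split.
    + field_simplify_eq; [| exact Nk]. nra.
    + field; exact Nk. }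
destruct Hu as [u [Huu Heu]].
exists u, (vec (py e * pz u - pz e * py u) (pz e * px u - px e * pz u)
               (px e * py u - py e * px u)).
assert (Gram : forall x, rdot x e ^ 2 + rdot x u ^ 2 +
  rdot x (vec (py e * pz u - pz e * py u) (pz e * px u - px e * pz u)
               (px e * py u - py e * px u)) ^ 2 = enorm x ^ 2).
{ intros x. rewrite enorm_sqr.
  transitivity (rdot x e ^ 2 + rdot x u ^ 2
    + (rdot x x * (rdot e e * rdot u u - rdot e u ^ 2)
       - rdot x e * (rdot x e * rdot u u - rdot e u * rdot x u)
       + rdot x u * (rdot x e * rdot e u - rdot e e * rdot x u))).
  - unfold rdot, vec, px, py, pz; simpl; ring.
  - rewrite He, Huu, Heu; ring. }
repeat split; try assumption.
- match goal with |- rdot ?v ?v = 1 => set (w := v) in * end.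
  transitivity (rdot e e * rdot u u - rdot e u ^ 2).
  + unfold w, rdot, vec, px, py, pz; simpl; ring.
  + rewrite He, Huu, Heu; ring.
- unfold rdot, vec, px, py, pz; simpl; ring.
- unfold rdot, vec, px, py, pz; simpl; ring.
Qed.

Lemma null_circle_null (e u v : R3) (t : R) :
  orthonormal e u v -> null_vector (null_circle e u v t).
Proof.
intros [He [Hu [Hv [Heu [Hev [Huv _]]]]]].
unfold null_vector, null_circle, Cmult, Cplus, RtoC; simpl. f_equal.
- transitivity (rdot e e - (rdot u u * (cos t * cos t)
                  + rdot v v * (sin t * sin t)
                  + 2 * rdot u v * (cos t * sin t))); [unfold rdot; ring |].
  rewrite He, Hu, Hv, Huv. pose proof (sin2_cos2 t) as T; unfold Rsqr in T. lra.
- transitivity (2 * (rdot e u * cos t + rdot e v * sin t));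
    [unfold rdot; ring |].
  rewrite Heu, Hev; ring.
Qed.

Lemma cdot_null_circle (e u v x : R3) (t : R) :
  cdot x (null_circle e u v t)
  = (rdot x e, rdot x u * cos t + rdot x v * sin t).
Proof.
unfold cdot, null_circle, rdot, Cmult, Cplus, RtoC; simpl; f_equal; ring.
Qed.

Lemma cdot_null_circle_bound (e u v x : R3) (t : R) :
  orthonormal e u v -> Cmod (cdot x (null_circle e u v t)) <= enorm x.
Proof.
intros [_ [_ [_ [_ [_ [_ HP]]]]]]. rewrite cdot_null_circle.
unfold Cmod; cbn [fst snd].
rewrite <- (sqrt_pow2 (enorm x)) by apply enorm_ge_0.
apply sqrt_le_1_alt. rewrite <- HP.
pose proof (sin2_cos2 t) as T; unfold Rsqr in T.
set (p := rdot x u); set (q := rdot x v).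
assert (0 <= (p * sin t - q * cos t) ^ 2) by apply pow2_ge_0.
assert ((p * cos t + q * sin t) ^ 2 + (p * sin t - q * cos t) ^ 2
        = (p ^ 2 + q ^ 2) * (sin t * sin t + cos t * cos t)) by ring.
rewrite T in H0. lra.
Qed.

Lemma cdot_plus (x y : R3) (w : C3) :
  cdot (plus x y) w = (cdot x w + cdot y w)%C.
Proof.
unfold cdot.
change (px (plus x y)) with (px x + px y).
change (py (plus x y)) with (py x + py y).
change (pz (plus x y)) with (pz x + pz y). rewrite !RtoC_plus; ring.
Qed.

Lemma C_continuous_trig (a p q : R) :
  C_continuous (fun t => (a, p * cos t + q * sin t)).
Proof.
apply C_continuous_pair; intros t; [apply continuous_const |].
apply (ex_derive_continuous (V := R_NormedModule)); auto_derive; auto.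
Qed.

Lemma C_continuous_cdot (e u v x : R3) :
  C_continuous (fun t => cdot x (null_circle e u v t)).
Proof.
unfold cdot, null_circle; cbn [c1 c2 c3].
apply C_continuous_plus; [apply C_continuous_plus |];
  (apply C_continuous_mult;
     [apply C_continuous_const | apply C_continuous_trig]).
Qed.

Lemma C_continuous_null_coeff (e u v : R3) (n : nat) (m : Z) :
  C_continuous (fun t => null_coeff n m (null_circle e u v t)).
Proof.
apply C_continuous_mult; apply C_continuous_pow; [| apply C_continuous_trig].
destruct (0 <=? m)%Z.
- apply C_continuous_minus; [apply C_continuous_trig |].
  apply C_continuous_mult; [apply C_continuous_const | apply C_continuous_trig].
- apply C_continuous_opp, C_continuous_plus; [apply C_continuous_trig |].
  apply C_continuous_mult; [apply C_continuous_const | apply C_continuous_trig].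
Qed.

(** The coefficients, on the solid harmonics, of the mean of
    [sum_k b_k (x.w) ^ k] over the null vectors [w] of a circle. *)
Definition mean_coeff (e u v : R3) (b : nat -> R -> C) (k : nat) (m : Z) : C :=
  mean (fun t => (/ 2) ^ k * null_coeff k m (null_circle e u v t) * b k t)%C.

(** [null_power_expansion] under the mean. *)
Lemma solid_sum_mean_coeff (e u v : R3) (b : nat -> R -> C) (N : nat) (x : R3) :
  orthonormal e u v -> (forall k, C_continuous (b k)) ->
  solid_sum (mean_coeff e u v b) N x
  = mean (fun t =>
      Csum (fun k => b k t * cdot x (null_circle e u v t) ^ k)%C N).
Proof.
intros Ho Hb.
assert (Hc : forall k m, C_continuous
   (fun t => (/ 2) ^ k * null_coeff k m (null_circle e u v t) * b k t)%C).
{ intros k m; apply C_continuous_mult; [| apply Hb].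
  apply C_continuous_mult; [apply C_continuous_const |].
  apply C_continuous_null_coeff. }
rewrite mean_Csum.
2: { intros k; apply C_continuous_mult; [apply Hb |].
     apply C_continuous_pow, C_continuous_cdot. }
apply Csum_ext; intros k _.
rewrite (mean_ext _ (fun t => Csum (fun j => (fun m =>
   (/ 2) ^ k * null_coeff k m (null_circle e u v t) * b k t * solid_poly k m x)
   (Z.of_nat j - Z.of_nat k)%Z) (2 * k))%C).
- rewrite mean_Csum.
  + apply Csum_ext; intros j _. symmetry; apply mean_mult_r, Hc.
  + intros j; apply C_continuous_mult; [apply Hc | apply C_continuous_const].
- intros t.
  assert (H2 : RtoC 2 <> 0) by (intros E; apply RtoC_inj in E; lra).
  transitivity (/ 2 ^ k * b k t * (2 * cdot x (null_circle e u v t)) ^ k)%C.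
  + rewrite Cpow_mult_l. field. now apply Cpow_nz.
  + rewrite null_power_expansion by now apply null_circle_null.
    rewrite sum_orders_mult_l. apply Csum_ext; intros j _.
    rewrite Cpow_inv by exact H2. ring.
Qed.

(** * The Newtonian potential as a mean of inverse null forms *)

Section PotentialMean.

Variables A p q : R.
Hypothesis HA : 0 < A.

Let K := sqrt (A ^ 2 + p ^ 2 + q ^ 2).
Let g (t : R) : R := p * sin t - q * cos t.
Let dg (t : R) : R := p * cos t + q * sin t.

Lemma g_derive (t : R) : is_derive g t (dg t).
Proof. unfold g, dg; auto_derive; [auto | ring]. Qed.

Lemma dg_derive (t : R) : is_derive dg t (- g t).
Proof. unfold g, dg; auto_derive; [auto | ring]. Qed.

Lemma K_pos : 0 < K.
Proof. apply sqrt_lt_R0; nra. Qed.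

Lemma K_sqr (t : R) : K ^ 2 = A ^ 2 + g t ^ 2 + dg t ^ 2.
Proof.
unfold K; rewrite pow2_sqrt by nra.
pose proof (sin2_cos2 t) as T; unfold Rsqr in T.
unfold g, dg.
transitivity (A ^ 2 + (p ^ 2 + q ^ 2) * (sin t * sin t + cos t * cos t));
  [rewrite T | ]; ring.
Qed.

Lemma g_bound (t : R) : - K < g t < K.
Proof.
pose proof (K_sqr t); pose proof K_pos.
assert (g t ^ 2 < K ^ 2) by nra. split; nra.
Qed.

(** With a phase [t0] such that [dg] is a multiple of [cos (t - t0)], the
    textbook primitive is [atan (A / K * tan (t - t0)) / K]. The addition
    formula of the tangent, applied to the difference of this arctangent and
    [t - t0], gives the primitive used here, which is smooth across the poles
    of the tangent. *)
Lemma potential_RInt_Re :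
  is_RInt (fun t => A / (A ^ 2 + (- dg t) ^ 2)) 0 (2 * PI) (2 * PI / K).
Proof.
pose proof K_pos as HK.
assert (HD : forall t, 0 < K * (A + K) - g t ^ 2).
{ intros t. pose proof (K_sqr t). pose proof (pow2_ge_0 (dg t)). nra. }
assert (Hn : forall t, 0 < A ^ 2 + dg t ^ 2).
{ intros t; pose proof (pow2_ge_0 (dg t)); nra. }
evar_last.
- apply (is_RInt_derive (V := R_CompleteNormedModule)
    (fun t => (t + atan (- (g t * dg t) / (K * (A + K) - g t ^ 2))) / K)).
  + intros t _. pose proof (g_derive t) as Hg; pose proof (dg_derive t) as Hdg.
    pose proof (HD t) as HDt. pose proof (Hn t) as Hnt.
    auto_derive.
    * repeat split; try (eexists; eassumption); lra.
    * change (Derive (fun x : R => g x) t) with (Derive g t).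
      change (Derive (fun x : R => dg x) t) with (Derive dg t).
      rewrite (is_derive_unique _ _ _ Hg), (is_derive_unique _ _ _ Hdg).
      pose proof (K_sqr t) as HS. revert HDt HS Hnt.
      generalize (g t) as x, (dg t) as y; intros x y HDt HS Hnt.
      set (D := K * (A + K) - x ^ 2) in *.
      assert (E1 : D ^ 2 + (x * y) ^ 2 = (A + K) ^ 2 * (A ^ 2 + y ^ 2)).
      { unfold D. replace (y ^ 2) with (K ^ 2 - A ^ 2 - x ^ 2) by lra.
        replace ((x * y) ^ 2) with (x ^ 2 * y ^ 2) by ring.
        replace (y ^ 2) with (K ^ 2 - A ^ 2 - x ^ 2) by lra. ring. }
      assert (E2 : D ^ 2 + (x * y) ^ 2 + ((x ^ 2 - y ^ 2) * D - 2 * (x * y) ^ 2)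
                   = K * A * (A + K) ^ 2).
      { unfold D.
        replace ((x * y) ^ 2) with (x ^ 2 * y ^ 2) by ring.
        replace (y ^ 2) with (K ^ 2 - A ^ 2 - x ^ 2) by lra. ring. }
      replace (K * (A + K) + - (x * (x * 1))) with D by (unfold D; ring).
      clearbody D.
      transitivity ((D ^ 2 + (x * y) ^ 2
                     + ((x ^ 2 - y ^ 2) * D - 2 * (x * y) ^ 2))
                    / (D ^ 2 + (x * y) ^ 2) / K).
      -- field. pose proof (pow2_ge_0 (x * y)). repeat split; nra.
      -- rewrite E2, E1. field. repeat split; lra.
  + intros t _. apply (ex_derive_continuous (V := R_NormedModule)).
    pose proof (dg_derive t) as Hdg. pose proof (Hn t) as Hnt.
    auto_derive. repeat split; try (eexists; eassumption). nra.
- assert (E0 : g (2 * PI) = g 0)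
    by (unfold g; now rewrite sin_2PI, cos_2PI, sin_0, cos_0).
  assert (E1 : dg (2 * PI) = dg 0)
    by (unfold dg; now rewrite sin_2PI, cos_2PI, sin_0, cos_0).
  rewrite E0, E1. unfold minus, plus, opp; simpl. field; lra.
Qed.

(** The integrand is [dg / (K ^ 2 - g ^ 2)], the derivative of
    [artanh (g / K) / K]. *)
Lemma potential_RInt_Im :
  is_RInt (fun t => - - dg t / (A ^ 2 + (- dg t) ^ 2)) 0 (2 * PI) 0.
Proof.
pose proof K_pos as HK.
assert (Hn : forall t, 0 < A ^ 2 + dg t ^ 2).
{ intros t; pose proof (pow2_ge_0 (dg t)); nra. }
evar_last.
- apply (is_RInt_derive (V := R_CompleteNormedModule)
    (fun t => (ln (K + g t) - ln (K - g t)) / (2 * K))).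
  + intros t _. pose proof (g_derive t) as Hg.
    pose proof (g_bound t) as Hb. pose proof (Hn t) as Hnt.
    auto_derive.
    * repeat split; try (eexists; eassumption); lra.
    * change (Derive (fun x : R => g x) t) with (Derive g t).
      rewrite (is_derive_unique _ _ _ Hg).
      replace (A ^ 2 + (- dg t) ^ 2) with ((K + g t) * (K - g t))
        by (pose proof (K_sqr t); lra).
      field. lra.
  + intros t _. apply (ex_derive_continuous (V := R_NormedModule)).
    pose proof (dg_derive t) as Hdg. pose proof (Hn t) as Hnt.
    auto_derive. repeat split; try (eexists; eassumption). nra.
- assert (E0 : g (2 * PI) = g 0)
    by (unfold g; now rewrite sin_2PI, cos_2PI, sin_0, cos_0).
  rewrite E0. unfold minus, plus, opp; simpl. field; lra.
Qed.

(** The integrand is [/ (A - i dg t)]; its imaginary part integrates to zero. *)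
Lemma mean_potential :
  mean (fun t => / (A, - (p * cos t + q * sin t))%R)%C
  = RtoC (/ sqrt (A ^ 2 + p ^ 2 + q ^ 2)).
Proof.
fold K. apply mean_unique. rewrite <- RtoC_mult.
apply is_CInt_pair; cbn [Re Im fst snd RtoC Cinv].
- exact potential_RInt_Re.
- exact potential_RInt_Im.
Qed.

End PotentialMean.

(** * Truncated power series in the distance to the centre *)

(** Coefficient sequences stand for power series in [y]; this is the
    multiplication by [z + y]. *)
Definition mul_binomial (z : C) (f : nat -> C) (j : nat) : C :=
  (z * f j + match j with O => 0 | S j' => f j' end)%C.

Definition mul_binomial_pow (z : C) (k : nat) (f : nat -> C) : nat -> C :=
  Nat.iter k (mul_binomial z) f.

Definition unit_series (j : nat) : C := if (j =? 0)%nat then 1 else 0.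

(** The expansion of [1 / (L - z - y)] in powers of [y]. *)
Definition inverse_series (L : R) (z : C) (j : nat) : C :=
  ((/ (L - z)) ^ (j + 1))%C.

Lemma mul_binomial_sum (z y : C) (f : nat -> C) (N : nat) :
  f (S N) = 0 ->
  Csum (fun j => mul_binomial z f j * y ^ j)%C (S N)
  = ((z + y) * Csum (fun j => f j * y ^ j)%C N)%C.
Proof.
intros H0.
transitivity (z * Csum (fun j => f j * y ^ j) (S N)
  + Csum (fun j => match j with O => 0 | S j' => f j' end * y ^ j) (S N))%C.
- rewrite <- Csum_mult_l, <- Csum_plus. apply Csum_ext; intros j _.
  unfold mul_binomial; ring.
- rewrite (Csum_S (fun j => f j * y ^ j)%C), H0, Csum_head.
  rewrite (Csum_ext (fun k => f k * y ^ S k)%C (fun k => y * (f k * y ^ k))%C)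
    by (intros; rewrite Cpow_S; ring).
  rewrite Csum_mult_l; ring.
Qed.

Lemma binomial_support (z : C) (k j : nat) :
  (k < j)%nat -> mul_binomial_pow z k unit_series j = 0.
Proof.
revert j; induction k as [|k IH]; intros j Hj.
- destruct j; [lia | reflexivity].
- change (mul_binomial z (mul_binomial_pow z k unit_series) j = 0).
  unfold mul_binomial. rewrite IH by lia.
  destruct j; [lia | rewrite IH by lia; ring].
Qed.

Lemma binomial_power_sum (z y : C) (k N : nat) :
  (k <= N)%nat ->
  Csum (fun j => mul_binomial_pow z k unit_series j * y ^ j)%C N
  = ((z + y) ^ k)%C.
Proof.
revert N; induction k as [|k IH]; intros N HN.
- rewrite (Csum_single _ N 0); [change (1 * 1 = 1)%C; ring | lia |].
  intros [|j] _ Nj; [lia | change (0 * y ^ S j = 0)%C; ring].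
- destruct N as [|N]; [lia |].
  rewrite Cpow_S, <- (IH N) by lia.
  apply (mul_binomial_sum z y (mul_binomial_pow z k unit_series)).
  apply binomial_support; lia.
Qed.

(** This is [(L - z - y) * 1 / (L - z - y) = 1], multiplied by [(z + y) ^ k]. *)
Lemma mul_binomial_pow_inverse (L : R) (z : C) (k j : nat) :
  (L - z)%C <> 0 ->
  (L * mul_binomial_pow z k (inverse_series L z) j)%C
  = (mul_binomial_pow z (k + 1) (inverse_series L z) j
     + mul_binomial_pow z k unit_series j)%C.
Proof.
intros HS. rewrite Nat.add_1_r. revert j; induction k as [|k IH]; intros j.
- change (L * inverse_series L z j
          = mul_binomial z (inverse_series L z) j + unit_series j)%C.
  unfold mul_binomial, inverse_series, unit_series.
  destruct j as [|j]; simpl.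
  + field; exact HS.
  + replace (j + 1)%nat with (1 + j)%nat by lia.
    rewrite Cpow_add_r. simpl. field; exact HS.
- change (L * mul_binomial z (mul_binomial_pow z k (inverse_series L z)) j
    = mul_binomial z (mul_binomial_pow z (S k) (inverse_series L z)) j
      + mul_binomial z (mul_binomial_pow z k unit_series) j)%C.
  unfold mul_binomial.
  destruct j as [|j].
  + transitivity (z * (L * mul_binomial_pow z k (inverse_series L z) 0))%C;
      [ring |].
    rewrite IH; ring.
  + transitivity
      (z * (L * mul_binomial_pow z k (inverse_series L z) (S j))
      + L * mul_binomial_pow z k (inverse_series L z) j)%C; [ring |].
    rewrite !IH; ring.
Qed.

(** Iterating [mul_binomial_pow_inverse] gives the remainder of the geometric
    series of [1 / (L - z - y)] in powers of [z + y], coefficientwise in [y]. *)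
Lemma inverse_series_remainder (L : R) (z : C) (p j : nat) :
  RtoC L <> 0 -> (L - z)%C <> 0 ->
  (inverse_series L z j
   - Csum (fun k => (/ L) ^ (k + 1) * mul_binomial_pow z k unit_series j) p)%C
  = ((/ L) ^ (p + 1) * mul_binomial_pow z (p + 1) (inverse_series L z) j)%C.
Proof.
intros HS HSz. induction p as [|p IH].
- rewrite Csum_O. pose proof (mul_binomial_pow_inverse L z 0 j HSz) as H.
  change (mul_binomial_pow z 0 (inverse_series L z) j)
    with (inverse_series L z j) in H.
  transitivity (/ L * (L * inverse_series L z j)
                - / L * mul_binomial_pow z 0 unit_series j)%C.
  + simpl. field; exact HS.
  + rewrite H. simpl. ring.
- rewrite Csum_S.
  transitivity ((inverse_series L z j
     - Csum (fun k => (/ L) ^ (k + 1) * mul_binomial_pow z k unit_series j) p)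
     - (/ L) ^ (S p + 1)
       * mul_binomial_pow z (S p) unit_series j)%C; [ring |].
  rewrite IH. pose proof (mul_binomial_pow_inverse L z (p + 1) j HSz) as H.
  replace (S p) with (p + 1)%nat by lia.
  transitivity ((/ L) ^ (p + 1 + 1)
       * (L * mul_binomial_pow z (p + 1) (inverse_series L z) j)
     - (/ L) ^ (p + 1 + 1) * mul_binomial_pow z (p + 1) unit_series j)%C.
  + rewrite (Cpow_add_r _ (p + 1) 1). simpl (_ ^ 1)%C. field; exact HS.
  + rewrite H. ring.
Qed.

(** For the weighted norm [sum_(j <= q) |f j| y ^ j], multiplication by [z + y]
    is bounded by [|z| + y], truncated or not: truncation only drops a
    nonnegative term. *)
Lemma mul_binomial_norm (z : C) (f : nat -> C) (y : R) (q : nat) :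
  0 <= y ->
  sum_n (fun j => Cmod (mul_binomial z f j) * y ^ j) q
  <= (Cmod z + y) * sum_n (fun j => Cmod (f j) * y ^ j) q.
Proof.
intros Hy.
(* Keeping the dropped term [|f q| y ^ (q + 1)] makes the induction work. *)
assert (H : sum_n (fun j => Cmod (mul_binomial z f j) * y ^ j) q
            + y * (Cmod (f q) * y ^ q)
            <= (Cmod z + y) * sum_n (fun j => Cmod (f j) * y ^ j) q).
{ induction q as [|q IH].
  - rewrite !sum_O. unfold mul_binomial. rewrite Cplus_0_r, Cmod_mult.
    simpl; lra.
  - rewrite !sum_Sn.
    set (s1 := sum_n (fun j => Cmod (mul_binomial z f j) * y ^ j) q) in *.
    set (s2 := sum_n (fun j => Cmod (f j) * y ^ j) q) in *.
    change (s1 + Cmod (mul_binomial z f (S q)) * y ^ S q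
            + y * (Cmod (f (S q)) * y ^ S q)
            <= (Cmod z + y) * (s2 + Cmod (f (S q)) * y ^ S q)).
    assert (Ht : Cmod (mul_binomial z f (S q))
                 <= Cmod z * Cmod (f (S q)) + Cmod (f q)).
    { unfold mul_binomial. rewrite <- Cmod_mult. apply Cmod_triangle. }
    apply (Rmult_le_compat_r (y ^ S q)) in Ht; [| now apply pow_le].
    simpl in *. lra. }
pose proof (Cmod_ge_0 (f q)). pose proof (pow_le y q Hy).
assert (0 <= y * (Cmod (f q) * y ^ q)) by (repeat apply Rmult_le_pos; auto).
lra.
Qed.

Lemma mul_binomial_pow_norm (z : C) (f : nat -> C) (y : R) (p q : nat) :
  0 <= y ->
  sum_n (fun j => Cmod (mul_binomial_pow z p f j) * y ^ j) q
  <= (Cmod z + y) ^ p * sum_n (fun j => Cmod (f j) * y ^ j) q.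
Proof.
intros Hy; induction p as [|p IH].
{ simpl pow; rewrite Rmult_1_l; apply Rle_refl. }
eapply Rle_trans;
  [apply (mul_binomial_norm z (mul_binomial_pow z p f) y q Hy) |].
simpl pow. rewrite Rmult_assoc. apply Rmult_le_compat_l; [| exact IH].
pose proof (Cmod_ge_0 z); lra.
Qed.

Lemma Cmod_RtoC_minus (L : R) (z : C) : L - Cmod z <= Cmod (L - z).
Proof.
pose proof (Cmod_triangle (L - z) z) as H.
replace (L - z + z)%C with (RtoC L) in H by ring.
rewrite Cmod_R in H. pose proof (Rle_abs L). lra.
Qed.

Lemma Cmod_pos_neq_0 (z : C) : 0 < Cmod z -> z <> 0.
Proof. apply Cmod_gt_0. Qed.

Lemma inverse_series_norm (L : R) (z : C) (y : R) (q : nat) :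
  0 <= y -> Cmod z + y < L ->
  sum_n (fun j => Cmod (inverse_series L z j) * y ^ j) q <= / (L - Cmod z - y).
Proof.
intros Hy HS. set (d := L - Cmod z). assert (Hd : y < d) by (unfold d; lra).
pose proof (Cmod_RtoC_minus L z) as Hm. fold d in Hm.
assert (Hgeo : sum_n (fun j => (/ d) ^ (j + 1) * y ^ j) q
               = (1 - (y / d) ^ (q + 1)) / (d - y)).
{ induction q as [|q IH].
  - rewrite sum_O. simpl. eq_R. field. lra.
  - rewrite sum_Sn, IH.
    change ((1 - (y / d) ^ (q + 1)) / (d - y)
            + (/ d) ^ (S q + 1) * y ^ S q
            = (1 - (y / d) ^ (S q + 1)) / (d - y)).
    replace (q + 1)%nat with (S q) by lia.
    replace (S q + 1)%nat with (S (S q)) by lia.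
    unfold Rdiv at 2 4; rewrite !Rpow_mult_distr. simpl pow. field. lra. }
eapply Rle_trans.
- apply sum_n_le with (g := fun j => (/ d) ^ (j + 1) * y ^ j). intros j _.
  apply Rmult_le_compat_r; [now apply pow_le |].
  unfold inverse_series. rewrite Cmod_pow.
  rewrite Cmod_inv by (apply Cmod_pos_neq_0; lra).
  apply pow_incr. split; [apply Rlt_le, Rinv_0_lt_compat; lra |].
  apply Rinv_le_contravar; lra.
- rewrite Hgeo. unfold Rdiv. rewrite <- (Rmult_1_l (/ (d - y))) at 2.
  apply Rmult_le_compat_r; [apply Rlt_le, Rinv_0_lt_compat; lra |].
  assert (0 <= (y * / d) ^ (q + 1)); [| lra].
  apply pow_le, Rmult_le_pos; [exact Hy | apply Rlt_le, Rinv_0_lt_compat; lra].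
Qed.

(** Truncating in [y] does not spoil the estimate of the remainder, because
    the majorant series have nonnegative coefficients. *)
Lemma truncated_remainder_bound (L : R) (z y : C) (p q : nat) :
  Cmod z + Cmod y < L ->
  Cmod (Csum (fun j => inverse_series L z j * y ^ j) q
        - Csum (fun j => Csum (fun k =>
            (/ L) ^ (k + 1) * mul_binomial_pow z k unit_series j) p
            * y ^ j) q)%C
  <= ((Cmod z + Cmod y) / L) ^ (p + 1) / (L - Cmod z - Cmod y).
Proof.
intros HS. pose proof (Cmod_ge_0 z) as Hz; pose proof (Cmod_ge_0 y) as Hy.
assert (NS : RtoC L <> 0) by (intros E; apply RtoC_inj in E; lra).
assert (NSz : (L - z)%C <> 0).
{ apply Cmod_pos_neq_0. pose proof (Cmod_RtoC_minus L z); lra. }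
replace (_ - _)%C with ((/ L) ^ (p + 1)
  * Csum (fun j =>
      mul_binomial_pow z (p + 1) (inverse_series L z) j * y ^ j) q)%C.
2: { rewrite <- Csum_mult_l.
  match goal with |- _ = (?a - ?b)%C =>
    replace (a - b)%C with (a + (- (1)) * b)%C by ring end.
  rewrite <- Csum_mult_l, <- Csum_plus. apply Csum_ext; intros j _.
  rewrite Cmult_assoc, <- inverse_series_remainder by assumption. ring. }
rewrite Cmod_mult, Cmod_pow, Cmod_inv, Cmod_R, (Rabs_pos_eq L)
  by (lra || exact NS).
assert (H : Cmod (Csum (fun j =>
    mul_binomial_pow z (p + 1) (inverse_series L z) j * y ^ j)%C q)
  <= (Cmod z + Cmod y) ^ (p + 1) * / (L - Cmod z - Cmod y)).
{ eapply Rle_trans; [apply Csum_Cmod |].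
  rewrite (sum_n_ext _ (fun j =>
      Cmod (mul_binomial_pow z (p + 1) (inverse_series L z) j) * Cmod y ^ j))
    by (intros; rewrite Cmod_mult, Cmod_pow; reflexivity).
  eapply Rle_trans; [now apply mul_binomial_pow_norm |].
  apply Rmult_le_compat_l; [apply pow_le; lra |].
  now apply inverse_series_norm. }
unfold Rdiv. rewrite Rpow_mult_distr.
apply (Rmult_le_compat_l ((/ L) ^ (p + 1))) in H.
- lra.
- apply pow_le, Rlt_le, Rinv_0_lt_compat; lra.
Qed.

(** * Local expansions of the potential and of its own expansions *)

Lemma C_continuous_mul_binomial_pow (z : R -> C) (k : nat) (f : R -> nat -> C)
    (j : nat) :
  C_continuous z -> (forall i, C_continuous (fun t => f t i)) ->
  C_continuous (fun t => mul_binomial_pow (z t) k (f t) j).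
Proof.
intros Hz Hf; revert j; induction k as [|k IH]; intros j; [apply Hf |].
apply (C_continuous_plus
  (fun t => z t * mul_binomial_pow (z t) k (f t) j)%C
  (fun t => match j with
            | O => 0
            | S j' => mul_binomial_pow (z t) k (f t) j'
            end)%C).
- apply C_continuous_mult; [exact Hz | apply IH].
- destruct j; [apply C_continuous_const | apply IH].
Qed.

Lemma C_continuous_inverse_series (L : R) (z : R -> C) (j : nat) :
  C_continuous z -> (forall t, (L - z t)%C <> 0) ->
  C_continuous (fun t => inverse_series L (z t) j).
Proof.
intros Hz HS. apply C_continuous_pow, C_continuous_inv; [| exact HS].
apply C_continuous_minus; [apply C_continuous_const | exact Hz].
Qed.

Definition source_frame (s e u v : R3) : Prop :=
  orthonormal e u v /\ s = scal (enorm s) e.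

Lemma source_frame_exists (s : R3) :
  0 < enorm s -> exists e u v, source_frame s e u v.
Proof.
intros Hs. set (e := scal (/ enorm s) s).
assert (He : rdot e e = 1).
{ rewrite <- enorm_sqr. unfold e. rewrite enorm_scal, Rabs_pos_eq.
  - rewrite Rinv_l by lra; ring.
  - apply Rlt_le, Rinv_0_lt_compat, Hs. }
destruct (orthonormal_exists e He) as [u [v Ho]].
exists e, u, v; split; [exact Ho |].
unfold e. rewrite scal_assoc. unfold mult; simpl. rewrite Rinv_r by lra.
symmetry; apply (scal_one (K := R_Ring)).
Qed.

(** In the frame of the source, [|x - s| ^ 2] is
    [(|s| - x.e) ^ 2 + (x.u) ^ 2 + (x.v) ^ 2], so this is [mean_potential]. *)
Lemma point_source_mean (s e u v x : R3) :
  source_frame s e u v -> enorm x < enorm s ->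
  point_source s x
  = mean (fun t => / (enorm s - cdot x (null_circle e u v t)))%C.
Proof.
intros [Ho Es] Hx. set (L := enorm s) in *.
assert (HA : 0 < L - rdot x e).
{ pose proof (cdot_null_circle_bound e u v x 0 Ho) as H.
  rewrite cdot_null_circle in H.
  pose proof (re_le_Cmod (rdot x e, rdot x u * cos 0 + rdot x v * sin 0)) as H'.
  simpl in H'. pose proof (Rle_abs (rdot x e)). lra. }
rewrite (mean_ext _ (fun t =>
  / (L - rdot x e, - (rdot x u * cos t + rdot x v * sin t))%R)%C).
2: { intros t. rewrite cdot_null_circle. f_equal.
     unfold RtoC, Cminus, Cplus, Copp; simpl; f_equal; ring. }
rewrite mean_potential by exact HA.
unfold point_source. f_equal. unfold Rdiv; rewrite Rmult_1_l. f_equal.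
rewrite <- (sqrt_pow2 (enorm (minus x s))) by apply enorm_ge_0. f_equal.
destruct Ho as [He [Hu [Hv [Heu [Hev [Huv HP]]]]]].
rewrite <- HP.
assert (Hdot : forall w, rdot (minus x s) w = rdot x w - L * rdot e w).
{ intros w. rewrite Es. unfold rdot.
  change (px (minus x (scal L e))) with (px x - L * px e).
  change (py (minus x (scal L e))) with (py x - L * py e).
  change (pz (minus x (scal L e))) with (pz x - L * pz e). ring. }
rewrite !Hdot, He, Heu, Hev. ring.
Qed.

(** At the point [c + x], with [y = x.w], the integrand of [point_source_mean]
    is [1 / (|s| - c.w - y)]; these coefficients come from its expansion in
    powers of [y]. *)
Definition source_coeff (s e u v c : R3) : nat -> Z -> C :=
  mean_coeff e u v (fun j t =>
    inverse_series (enorm s) (cdot c (null_circle e u v t)) j).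

Lemma source_gap (L : R) (e u v x : R3) (t : R) :
  orthonormal e u v -> enorm x < L ->
  L - enorm x <= Cmod (L - cdot x (null_circle e u v t)).
Proof.
intros Ho Hx. pose proof (Cmod_RtoC_minus L (cdot x (null_circle e u v t))).
pose proof (cdot_null_circle_bound e u v x t Ho). lra.
Qed.

Lemma source_gap_neq_0 (L : R) (e u v x : R3) (t : R) :
  orthonormal e u v -> enorm x < L ->
  (L - cdot x (null_circle e u v t))%C <> 0.
Proof.
intros Ho Hx. apply Cmod_pos_neq_0.
pose proof (source_gap L e u v x t Ho Hx). lra.
Qed.

Lemma geometric_remainder (d y : C) (N : nat) :
  d <> 0 -> (d - y)%C <> 0 ->
  (Csum (fun j => (/ d) ^ (j + 1) * y ^ j) N - / (d - y))%C
  = (- ((y / d) ^ (N + 1) / (d - y)))%C.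
Proof.
intros Hd Hy. induction N as [|N IH].
- rewrite Csum_O. simpl. field; auto.
- rewrite Csum_S.
  transitivity (Csum (fun j => (/ d) ^ (j + 1) * y ^ j) N - / (d - y)
    + (/ d) ^ (S N + 1) * y ^ S N)%C; [ring |].
  rewrite IH. replace (N + 1)%nat with (S N) by lia.
  replace (S N + 1)%nat with (S (S N)) by lia.
  unfold Cdiv. rewrite !Cpow_mult_l, !Cpow_S. field; auto.
Qed.

Lemma pow_small (x eps : R) :
  0 <= x < 1 -> 0 < eps ->
  exists N1, forall N, (N1 <= N)%nat -> x ^ (N + 1) <= eps.
Proof.
intros Hx He.
destruct (pow_lt_1_zero x ltac:(rewrite Rabs_pos_eq; lra) eps He) as [N1 H].
exists N1; intros N HN. specialize (H (N + 1)%nat ltac:(lia)).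
pose proof (Rle_abs (x ^ (N + 1))). lra.
Qed.

(** For each null direction the expansion is a geometric series of ratio at
    most [rho / (|s| - |c|)] in modulus. *)
Lemma source_sphere_expansion (s e u v c : R3) (rho : R) :
  source_frame s e u v -> 0 < rho -> enorm c + rho < enorm s ->
  sphere_expansion (source_coeff s e u v c) (point_source s) c rho.
Proof.
intros Hf Hrho Hc eps Heps. pose proof Hf as [Ho _].
set (L := enorm s) in *. pose proof (enorm_ge_0 c) as Hc0.
set (k := rho / (L - enorm c)).
assert (Hk : 0 <= k < 1).
{ unfold k; split; [apply Rlt_le, Rdiv_lt_0_compat; lra |].
  apply Rlt_div_l; lra. }
destruct (pow_small k (eps * (L - enorm c - rho)) Hk) as [N1 HN1].
{ apply Rmult_lt_0_compat; lra. }
exists N1; intros N HN xi Hxi.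
assert (Hrx : enorm (scal rho xi) = rho)
  by (rewrite enorm_scal, Hxi, Rabs_pos_eq; lra).
assert (Hx : enorm (plus c (scal rho xi)) < L)
  by (pose proof (enorm_triangle c (scal rho xi)); lra).
set (w := null_circle e u v).
assert (Cz : C_continuous (fun t => cdot c (w t))) by apply C_continuous_cdot.
assert (Cy : C_continuous (fun t => cdot (scal rho xi) (w t)))
  by apply C_continuous_cdot.
assert (Nz : forall t, (L - cdot c (w t))%C <> 0)
  by (intros t; apply source_gap_neq_0; [exact Ho | lra]).
assert (Nx : forall t, (L - cdot (plus c (scal rho xi)) (w t))%C <> 0)
  by (intros t; now apply source_gap_neq_0).
assert (Ci : forall j,
  C_continuous (fun t => inverse_series L (cdot c (w t)) j))
  by (intros j; now apply C_continuous_inverse_series).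
rewrite (point_source_mean s e u v) by assumption. fold L w.
unfold source_coeff. rewrite solid_sum_mean_coeff by assumption. fold L w.
assert (Cs : C_continuous (fun t => Csum (fun j =>
   inverse_series L (cdot c (w t)) j * cdot (scal rho xi) (w t) ^ j)%C N)).
{ apply (C_continuous_Csum (fun j t =>
   inverse_series L (cdot c (w t)) j * cdot (scal rho xi) (w t) ^ j)%C).
  intros j; apply C_continuous_mult; [apply Ci | now apply C_continuous_pow]. }
assert (Cv : C_continuous
  (fun t => / (L - cdot (plus c (scal rho xi)) (w t)))%C).
{ apply C_continuous_inv; [| exact Nx].
  apply C_continuous_minus;
    [apply C_continuous_const | apply C_continuous_cdot]. }
rewrite <- mean_minus by assumption.
apply mean_bound; [now apply C_continuous_minus |].
intros t. rewrite cdot_plus. specialize (Nx t); rewrite cdot_plus in Nx.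
pose proof (source_gap L e u v (plus c (scal rho xi)) t Ho Hx) as Gx.
pose proof (source_gap L e u v c t Ho ltac:(lra)) as Gc.
fold w in Gx, Gc. rewrite cdot_plus in Gx.
pose proof (cdot_null_circle_bound e u v (scal rho xi) t Ho) as By.
fold w in By. rewrite Hrx in By.
pose proof (enorm_triangle c (scal rho xi)) as Tr. rewrite Hrx in Tr.
specialize (Nz t).
set (z := cdot c (w t)) in *; set (y := cdot (scal rho xi) (w t)) in *.
replace (L - (z + y))%C with ((L - z) - y)%C in * by ring.
unfold inverse_series. rewrite geometric_remainder by assumption.
rewrite Cmod_opp, Cmod_div, Cmod_pow, Cmod_div by assumption.
apply Rle_div_l; [lra |].
eapply Rle_trans; [| apply Rle_trans with (1 := HN1 N HN)].
- apply pow_incr. pose proof (Cmod_ge_0 y). split.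
  + apply Rmult_le_pos; [assumption | apply Rlt_le, Rinv_0_lt_compat; lra].
  + unfold k, Rdiv. apply Rmult_le_compat; try lra.
    * apply Rlt_le, Rinv_0_lt_compat; lra.
    * apply Rinv_le_contravar; lra.
- apply Rmult_le_compat_l; lra.
Qed.

Lemma cdot_zero (w : C3) : cdot zero w = 0.
Proof.
unfold cdot. change (px zero) with 0; change (py zero) with 0.
change (pz zero) with 0. ring.
Qed.

(** With [y] as for [source_coeff], these coefficients come from re-expanding
    [sum_(k <= p) (c.w + y) ^ k / |s| ^ (k + 1)] in powers of [y]. *)
Definition truncated_source_coeff (s e u v c : R3) (p : nat) : nat -> Z -> C :=
  mean_coeff e u v (fun j t => Csum (fun k =>
    (/ enorm s) ^ (k + 1)
    * mul_binomial_pow (cdot c (null_circle e u v t)) k unit_series j)%C p).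

Lemma C_continuous_truncated (s e u v c : R3) (p j : nat) :
  C_continuous (fun t => Csum (fun k =>
    (/ enorm s) ^ (k + 1)
    * mul_binomial_pow (cdot c (null_circle e u v t)) k unit_series j)%C p).
Proof.
apply (C_continuous_Csum (fun k t => (/ enorm s) ^ (k + 1)
    * mul_binomial_pow (cdot c (null_circle e u v t)) k unit_series j)%C).
intros k; apply C_continuous_mult; [apply C_continuous_const |].
apply (C_continuous_mul_binomial_pow _ k (fun _ => unit_series));
  [apply C_continuous_cdot | intros; apply C_continuous_const].
Qed.

(** For [N >= p] the expansion is exact, by the binomial theorem. *)
Lemma truncated_sphere_expansion (s e u v c : R3) (p : nat) (rho0 rho : R) :
  source_frame s e u v -> 0 < rho0 -> rho0 < enorm s ->
  sphere_expansion (truncated_source_coeff s e u v c p)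
    (local_expansion p zero rho0 (point_source s)) c rho.
Proof.
intros Hf H0 H1 eps Heps. pose proof Hf as [Ho _].
exists p; intros N HN xi _.
set (x := scal rho xi).
rewrite (local_expansion_solid_sum p (source_coeff s e u v zero)).
2: exact H0.
2: { apply source_sphere_expansion; [exact Hf | exact H0 |].
     rewrite enorm_zero; lra. }
rewrite minus_zero_R3. unfold source_coeff, truncated_source_coeff.
rewrite !solid_sum_mean_coeff.
2, 4: exact Ho.
2: { intros j; apply C_continuous_inverse_series; [apply C_continuous_cdot |].
     intros t; apply source_gap_neq_0; [exact Ho | rewrite enorm_zero; lra]. }
2: { intros j; apply C_continuous_truncated. }
match goal with |- Cmod (?a - ?b) <= _ => replace a with b end.
{ replace (_ - _)%C with (RtoC 0) by ring. rewrite Cmod_0; lra. }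
apply mean_ext; intros t.
rewrite cdot_zero, cdot_plus. set (z := cdot c _); set (y := cdot x _).
transitivity (Csum (fun k => (/ enorm s) ^ (k + 1)
  * Csum (fun j => mul_binomial_pow z k unit_series j * y ^ j) N) p)%C.
- apply Csum_ext; intros k Hk. rewrite binomial_power_sum by lia.
  unfold inverse_series. do 3 f_equal. ring.
- transitivity (Csum (fun k => Csum (fun j => (/ enorm s) ^ (k + 1)
     * (mul_binomial_pow z k unit_series j * y ^ j)) N) p)%C.
  + apply Csum_ext; intros k _; symmetry; apply Csum_mult_l.
  + etransitivity; [apply (sum_n_switch (G := C_AbelianMonoid)) |].
    apply Csum_ext; intros j _. rewrite <- Csum_mult_r.
    apply Csum_ext; intros k _; ring.
Qed.

(** The potential is unbounded near its source, also along the segment from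
    the source to the centre, so that no ball on whose closure it is continuous
    contains the source. *)
Lemma admissible_radius_lt (s c : R3) (rho : R) :
  0 < enorm (minus s c) -> admissible_radius (point_source s) c rho ->
  rho < enorm (minus s c).
Proof.
intros Hd [Hrho [_ Hcont]]. set (d := enorm (minus s c)) in *.
apply Rnot_le_lt; intros Hle.
assert (Hs : ecball c rho s) by exact Hle.
specialize (Hcont s Hs).
pose proof (proj1 (filterlim_locally _ _) Hcont (mkposreal 1 Rlt_0_1)) as Hloc.
destruct Hloc as [delta Hdelta].
set (b := 1 / enorm (minus s s)).
(* The point at distance [m d] from [s] towards [c] is in the closed ball,
   within [delta] of [s], and has potential at least [|b| + 2]. *)
set (m := Rmin 1 (Rmin (delta / (2 * d)) (/ (d * (Rabs b + 2))))).
pose proof (cond_pos delta) as Hdp. pose proof (Rabs_pos b) as Hb.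
assert (Hm : 0 < m <= 1 /\ m <= delta / (2 * d) /\ m <= / (d * (Rabs b + 2))).
{ unfold m. repeat split.
  - repeat apply Rmin_glb_lt; [lra | apply Rdiv_lt_0_compat; lra |].
    apply Rinv_0_lt_compat, Rmult_lt_0_compat; lra.
  - apply Rmin_l.
  - eapply Rle_trans; [apply Rmin_r | apply Rmin_l].
  - eapply Rle_trans; [apply Rmin_r | apply Rmin_r]. }
destruct Hm as [[Hm0 Hm1] [Hm2 Hm3]].
set (x := plus s (scal (- m) (minus s c))).
assert (Exs : enorm (minus x s) = m * d).
{ replace (minus x s) with (scal (- m) (minus s c)).
  - rewrite enorm_scal, Rabs_Ropp, Rabs_pos_eq by lra. reflexivity.
  - unfold x. R3_ring. }
assert (Exc : enorm (minus x c) <= rho).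
{ replace (minus x c) with (scal (1 - m) (minus s c)).
  - rewrite enorm_scal, Rabs_pos_eq by lra. fold d. nra.
  - unfold x. R3_ring. }
assert (Hball : ball s delta x).
{ destruct (coord_bound (minus s c)) as [B1 [B2 B3]]. fold d in B1, B2, B3.
  assert (Hmd : m * d < delta).
  { apply Rle_lt_trans with (delta / 2); [| lra].
    replace (delta / 2) with (delta / (2 * d) * d) by (field; lra).
    apply Rmult_le_compat_r; lra. }
  assert (Hc : forall y, Rabs y <= d -> Rabs (- m * y) < delta).
  { intros y Hy. rewrite Rabs_mult, Rabs_Ropp, (Rabs_pos_eq m) by lra.
    eapply Rle_lt_trans; [| exact Hmd].
    apply Rmult_le_compat_l; [lra | exact Hy]. }
  split; [split |].
  - change (Rabs (px s + - m * px (minus s c) - px s) < delta).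
    replace (_ - _) with (- m * px (minus s c)) by ring. now apply Hc.
  - change (Rabs (py s + - m * py (minus s c) - py s) < delta).
    replace (_ - _) with (- m * py (minus s c)) by ring. now apply Hc.
  - change (Rabs (pz s + - m * pz (minus s c) - pz s) < delta).
    replace (_ - _) with (- m * pz (minus s c)) by ring. now apply Hc. }
specialize (Hdelta x Hball Exc). destruct Hdelta as [Hre _].
change (Rabs (1 / enorm (minus x s) - b) < 1) in Hre. rewrite Exs in Hre.
assert (Hlow : Rabs b + 2 <= 1 / (m * d)).
{ apply Rle_div_r; [nra |].
  replace 1 with ((Rabs b + 2) * (/ (d * (Rabs b + 2)) * d)) by (field; lra).
  apply Rmult_le_compat_l; [lra |]. apply Rmult_le_compat_r; lra. }
apply Rabs_def2 in Hre. pose proof (Rle_abs b). lra.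
Qed.

(** The frame of the source as seen from [c] gives an expansion on every
    admissible sphere, the frame as seen from the origin only on small ones;
    the coefficients agree because both are local coefficients on a small
    sphere. *)
Lemma source_local_expansion (q : nat) (s e u v c x : R3) (rho : R) :
  source_frame s e u v -> enorm c < enorm s ->
  0 < rho -> rho < enorm (minus s c) ->
  local_expansion q c rho (point_source s) x
  = solid_sum (source_coeff s e u v c) q (minus x c).
Proof.
intros Hf Hc H0 H1.
destruct (source_frame_exists (minus s c)) as [e' [u' [v' Hf']]]; [lra |].
set (a' := source_coeff (minus s c) e' u' v' zero).
assert (Ha' : forall r, 0 < r -> r < enorm (minus s c) ->
  sphere_expansion a' (point_source s) c r).
{ intros r Hr0 Hr1 eps Heps.
  destruct (source_sphere_expansion (minus s c) e' u' v' zero r Hf' Hr0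
    ltac:(rewrite enorm_zero; lra) eps Heps) as [N1 HN1].
  exists N1; intros N HN xi Hxi.
  replace (point_source s (plus c (scal r xi)))
    with (point_source (minus s c) (plus zero (scal r xi))); [now apply HN1 |].
  unfold point_source. do 3 f_equal. R3_ring. }
set (r := Rmin (enorm (minus s c) / 2) ((enorm s - enorm c) / 2)).
assert (Hr : 0 < r /\ r <= enorm (minus s c) / 2
             /\ r <= (enorm s - enorm c) / 2).
{ unfold r; repeat split;
    [apply Rmin_glb_lt; lra | apply Rmin_l | apply Rmin_r]. }
rewrite (local_expansion_solid_sum q a') by auto.
apply Csum_ext; intros n _. apply sum_orders_ext; intros m Hm. f_equal.
rewrite <- (local_coeff_expansion a' (point_source s) c r n m)
  by (try apply Ha'; auto; lra).
apply local_coeff_expansion; [lra | | exact Hm].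
apply source_sphere_expansion; [exact Hf | lra | lra].
Qed.

Theorem theorem3p7 :
  forall (p q : nat) (R0 r : R) (s c t : R3),
    0 < r -> r < R0 ->
    R0 <= enorm s -> enorm c <= r -> enorm (minus t c) <= r - enorm c ->
    forall rho0 rho1 rho2 : R,
      admissible_radius (point_source s) zero rho0 ->
      admissible_radius (point_source s) c rho1 ->
      admissible_radius (local_expansion p zero rho0 (point_source s)) c rho2 ->
      Cmod (local_expansion q c rho1 (point_source s) t
            - local_expansion q c rho2
                (local_expansion p zero rho0 (point_source s)) t)%C
      <= 1 / (R0 - r) * (r / R0) ^ (p + 1).
Proof.
intros p q R0 r s c t Hr HR Hs Hc Ht rho0 rho1 rho2 A0 A1 A2.
assert (Hsc : 0 < enorm (minus s c)).
{ assert (T : enorm s <= enorm (minus s c) + enorm c); [| lra].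
  replace s with (plus (minus s c) c) at 1 by R3_ring. apply enorm_triangle. }
assert (B0 : rho0 < enorm s).
{ rewrite <- (minus_zero_R3 s). apply admissible_radius_lt; [| exact A0].
  rewrite minus_zero_R3; lra. }
assert (B1 : rho1 < enorm (minus s c)) by now apply admissible_radius_lt.
destruct A0 as [P0 _], A1 as [P1 _], A2 as [P2 _].
destruct (source_frame_exists s ltac:(lra)) as [e [u [v Hf]]].
pose proof Hf as [Ho _].
rewrite (source_local_expansion q s e u v);
  [| exact Hf | lra | exact P1 | exact B1].
rewrite (local_expansion_solid_sum q (truncated_source_coeff s e u v c p))
  by (exact P2 || now apply truncated_sphere_expansion).
set (y := minus t c) in *. set (L := enorm s) in *.
pose proof (enorm_ge_0 c) as Hc0. pose proof (enorm_ge_0 y) as Hy0.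
assert (Ci : forall j, C_continuous (fun a =>
  inverse_series L (cdot c (null_circle e u v a)) j)).
{ intros j; apply C_continuous_inverse_series; [apply C_continuous_cdot |].
  intros a; apply source_gap_neq_0; [exact Ho | lra]. }
pose proof (C_continuous_truncated s e u v c p) as Ct.
unfold source_coeff, truncated_source_coeff.
rewrite !solid_sum_mean_coeff by assumption.
assert (Cf : forall b : nat -> R -> C, (forall j, C_continuous (b j)) ->
  C_continuous (fun a =>
    Csum (fun j => b j a * cdot y (null_circle e u v a) ^ j)%C q)).
{ intros b Hb.
  apply (C_continuous_Csum
           (fun j a => b j a * cdot y (null_circle e u v a) ^ j)%C).
  intros j; apply C_continuous_mult; [apply Hb |].
  apply C_continuous_pow, C_continuous_cdot. }
rewrite <- mean_minus by (apply Cf; assumption).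
apply mean_bound; [apply C_continuous_minus; apply Cf; assumption |].
intros a. fold L.
pose proof (cdot_null_circle_bound e u v c a Ho) as Bz.
pose proof (cdot_null_circle_bound e u v y a Ho) as By.
set (z := cdot c _) in *. set (yw := cdot y _) in *.
pose proof (Cmod_ge_0 z); pose proof (Cmod_ge_0 yw).
eapply Rle_trans; [apply truncated_remainder_bound; lra |].
unfold Rdiv. rewrite Rmult_1_l, Rmult_comm.
apply Rmult_le_compat.
- apply Rlt_le, Rinv_0_lt_compat; lra.
- apply pow_le, Rmult_le_pos; [lra | apply Rlt_le, Rinv_0_lt_compat; lra].
- apply Rinv_le_contravar; lra.
- apply pow_incr. split.
  + apply Rmult_le_pos; [lra | apply Rlt_le, Rinv_0_lt_compat; lra].
  + apply Rmult_le_compat; try lra.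
    * apply Rlt_le, Rinv_0_lt_compat; lra.
    * apply Rinv_le_contravar; lra.
Qed.
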